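(* Let $n\ge1$, $m\ge1$, $M=\mathbb{R}^{2n+1}(\boldsymbol x,\boldsymbol y,u)$ and let $G_1=\mathrm{CSp}(2n,\mathbb{R})=\mathrm{Sp}(2n,\mathbb{R})\times\mathbb{R}_+$ act on $M$ by the contact lift of its linear action on $V=\mathbb{R}^{2n}(\boldsymbol x,\boldsymbol y)$, and diagonally on $M^{\times m}$. Let $\mathcal{F}_{G_1}^m$ be the field of $G_1$-invariant real rational functions on $M^{\times m}$, and let $$\bar{\boldsymbol T}=\{T_k:1\le k<m\}\cup\{T_{ij}:1\le i\le 2n,\ i<j\le m\}.$$ Then the elements of $\bar{\boldsymbol T}$ are algebraically independent, $\mathcal{F}_{G_1}^m=\mathbb{R}(\bar{\boldsymbol T})$, and the transcendence degree of $\mathcal{F}_{G_1}^m$ over $\mathbb{R}$ is $$\bar d(m,n)=\begin{cases}(2n+1)m-n(2n+1)-1&\text{for } m\ge 2n,\\ \binom m2+m-1=\binom{m+1}2-1&\text{for } m\le 2n.\end{cases}$$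
   Context: Here $\boldsymbol x=(x^1,\dots,x^n)$, $\boldsymbol y=(y^1,\dots,y^n)$, and $\boldsymbol x\boldsymbol y=\sum_k x^ky^k$ etc. $M$ carries the contact form $\alpha=du-\boldsymbol y\,d\boldsymbol x$, and $V$ the symplectic form $\omega=\sum_k dx^k\wedge dy^k$. An element $g\in G_1$ is a linear map of $V$ with $g^*\omega=\lambda\omega$, $\lambda>0$; writing $(\boldsymbol x',\boldsymbol y')=g(\boldsymbol x,\boldsymbol y)$, its action on $M$ is $(\boldsymbol x,\boldsymbol y,u)\mapsto\bigl(\boldsymbol x',\boldsymbol y',\lambda(u-\tfrac12\boldsymbol x\boldsymbol y)+\tfrac12\boldsymbol x'\boldsymbol y'\bigr)$. A point of $M^{\times m}$ is an $m$-tuple of points $(\boldsymbol x_k,\boldsymbol y_k,u_k)$, $1\le k\le m$. Define $R_k=\boldsymbol x_k\boldsymbol y_k-2u_k$ ($1\le k\le m$), $R_{ij}=\boldsymbol x_i\boldsymbol y_j-\boldsymbol x_j\boldsymbol y_i$ ($1\le i<j\le m$), and $T_k=R_k/R_m$ ($1\le k<m$), $T_{ij}=R_{ij}/R_m$ ($1\le i<j\le m$). *)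

(* Defs.v *)
From mathcomp Require Import all_boot all_order all_algebra.
From mathcomp Require Import generic_quotient fraction.
From mathcomp Require Import classical_sets reals.
From mathcomp Require Import mpoly.

Set Implicit Arguments.
Unset Strict Implicit.
Unset Printing Implicit Defensive.

Import GRing.Theory Num.Theory.
Local Open Scope ring_scope.
Local Open Scope quotient_scope.

Section FieldExtension.
Variables (K L : fieldType) (iota : {rmorphism K -> L}).

(* A repetition in [s] makes it dependent: [s] is read as a family. *)
Definition alg_independent (s : seq L) : Prop :=
  forall P : {mpoly K[size s]}, mmap iota (tnth (in_tuple s)) P = 0 -> P = 0.

(* The smallest subfield of L containing iota(K) and the elements of s. *)
Definition adjoin (s : seq L) : set L := fun z =>
  forall E : {pred L}, divring_closed E ->
    (forall c, iota c \in E) -> {subset s <= E} -> z \in E.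

Definition algebraic_over (E : set L) (z : L) : Prop :=
  exists p : {poly L}, [/\ p != 0, forall i, E p`_i & root p z].

Definition transcendence_basis (E : set L) (s : seq L) : Prop :=
  [/\ forall z, z \in s -> E z,
      alg_independent s
    & forall z, E z -> algebraic_over (adjoin s) z].

Definition has_trdeg (E : set L) (d : nat) : Prop :=
  exists2 s : seq L, transcendence_basis E s & size s = d.

End FieldExtension.

Section ContactSpace.
Variables (R : realType) (n : nat).

Definition dot (S : comNzRingType) (a b : 'rV[S]_n) : S :=
  \sum_k a 0 k * b 0 k.

(* Vectors of V are rows (x, y). *)
Definition omega (v w : 'rV[R]_(n + n)) : R :=
  dot (lsubmx v) (rsubmx w) - dot (lsubmx w) (rsubmx v).

(* A linear map of V is v |-> v *m g; the conformal factor lam is determined by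
   g as soon as 0 < n. *)
Definition in_CSp (g : 'M[R]_(n + n)) (lam : R) : Prop :=
  0 < lam /\ forall v w, omega (v *m g) (w *m g) = lam * omega v w.

(* Points of M are rows (x, y, u), with coordinates in a commutative R-algebra:
   R itself for actual points, a polynomial ring for generic ones. *)
Section Points.
Variable S : comAlgType R.
Implicit Type p : 'rV[S]_(n + n + 1).

Definition pt_v p : 'rV[S]_(n + n) := lsubmx p.
Definition pt_x p : 'rV[S]_n := lsubmx (pt_v p).
Definition pt_y p : 'rV[S]_n := rsubmx (pt_v p).
Definition pt_u p : S := rsubmx p 0 0.

Definition contact_act (g : 'M[R]_(n + n)) (lam : R) p :
    'rV[S]_(n + n + 1) :=
  let v' := pt_v p *m map_mx (in_alg S) g in
  row_mx v'
    (const_mx (lam *: (pt_u p - 2^-1 *: dot (pt_x p) (pt_y p))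
               + 2^-1 *: dot (lsubmx v') (rsubmx v'))).

(* The points of M^m are the m x (2n+1) matrices, with one row per factor. *)
Definition diag_act m (g : 'M[R]_(n + n)) (lam : R)
    (P : 'M[S]_(m, n + n + 1)) : 'M[S]_(m, n + n + 1) :=
  \matrix_k contact_act g lam (row k P).

End Points.

Section RationalFunctions.
Variable m : nat.

Definition nvars : nat := m * (n + n + 1).

Definition polyfun : comAlgType R := {mpoly R[nvars]}.
Definition ratfun : fieldType := {fraction {mpoly R[nvars]}}.

Definition ratconst : {rmorphism R -> ratfun} :=
  (@tofrac {mpoly R[nvars]}) \o (@mpolyC nvars R).

(* The point of M^m whose coordinates are the coordinate functions. *)
Definition generic_point : 'M[polyfun]_(m, n + n + 1) :=
  vec_mx (\row_i ('X_i : {mpoly R[nvars]})).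

Definition pull_poly (g : 'M[R]_(n + n)) (lam : R) (p : {mpoly R[nvars]}) :
    {mpoly R[nvars]} :=
  p \mPo [tuple mxvec (diag_act g lam generic_point) 0 i | i < nvars].

(* f o g. For (g, lam) in CSp the action is an invertible polynomial map, so
   the denominator stays nonzero and the result does not depend on the
   representative chosen by repr. *)
Definition pull_rat (g : 'M[R]_(n + n)) (lam : R) (f : ratfun) : ratfun :=
  tofrac (pull_poly g lam (\n_(repr f)))
  / tofrac (pull_poly g lam (\d_(repr f))).

Definition invariant_field : set ratfun := fun f =>
  forall g lam, in_CSp g lam -> pull_rat g lam f = f.

Definition Rone (k : 'I_m) : polyfun :=
  let p := row k generic_point in dot (pt_x p) (pt_y p) - 2 * pt_u p.

Definition Rtwo (i j : 'I_m) : polyfun :=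
  let p := row i generic_point in
  let q := row j generic_point in
  dot (pt_x p) (pt_y q) - dot (pt_x q) (pt_y p).

Hypothesis m_gt0 : (0 < m)%N.

Definition last_factor : 'I_m := Ordinal (etrans (ltn_predL m) m_gt0).

Definition Tone (k : 'I_m) : ratfun :=
  tofrac (Rone k) / tofrac (Rone last_factor).

Definition Ttwo (i j : 'I_m) : ratfun :=
  tofrac (Rtwo i j) / tofrac (Rone last_factor).

(* Indices start at 0, so 1 <= k < m becomes k.+1 < m and i <= 2n becomes
   i < 2n. *)
Definition Tbar : seq ratfun :=
  [seq Tone k | k : 'I_m <- enum 'I_m & (k.+1 < m)%N] ++
  [seq Ttwo ij.1 ij.2 |
     ij : 'I_m * 'I_m <- enum {: 'I_m * 'I_m} & (ij.1 < 2 * n)%N && (ij.1 < ij.2)%N].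

End RationalFunctions.
End ContactSpace.

Arguments invariant_field R n m : clear implicits.
Arguments Tbar R n [m] m_gt0.

(* Main.v *)
(** In the coordinates v_k = (x_k, y_k) and R_k the group acts by v_k |-> v_k g,
    R_k |-> lam R_k, so the T's are invariant.

    Independence: every alternating matrix of rank at most 2n is X J X^T for some
    X with 2n columns, so the T's take all real values outside a proper
    hypersurface.

    Generation: by the same decomposition, carried out over the field generated by
    the T's, there is a point Y of M^m with coordinates in that field and with the
    same Gram matrix, up to the factor 1/R_m, as the generic point.  By Witt's
    theorem, at almost every real point P with R_m(P) > 0 the value of Y lies on
    the orbit of P.  So an invariant f satisfies f(P) = f(Y(P)) on a Zariski dense
    set, hence f = f(Y). *)

Require Import Defs.
From HB Require Import structures.
From mathcomp Require Import all_boot all_order all_algebra.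
From mathcomp Require Import generic_quotient fraction.
From mathcomp Require Import boolp classical_sets reals.
From mathcomp Require Import mpoly.
From mathcomp Require Import zify ring lra.

Set Implicit Arguments.
Unset Strict Implicit.
Unset Printing Implicit Defensive.

Import Order.TTheory GRing.Theory Num.Theory.
Local Open Scope ring_scope.
Local Open Scope quotient_scope.

Local Notation "x %:F" := (tofrac x).

(** * Alternating matrices and symplectic bases *)

(** The family contains T_ij only for i <= 2n, so products between two later vectors are not at
    hand. Hence Gram entries are prescribed for i <= 2n only. This suffices because for m > 2n the
    first 2n vectors are generically a basis of V, and each later vector is determined by its
    products with them.

    An alternating form, unlike a symmetric one, splits into hyperbolic planes without square roots.
    This keeps the coordinates of Y inside the field generated by the T's.

    Dividing by R_m absorbs the conformal factor. Since the group has only positive factors, real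
    points are compared on the half-space R_m > 0, which is Zariski dense.

    The obstacle is that Y is a special point, so a denominator of f may vanish at Y. The quotient
    representing f is therefore chosen after Y. Identities between fractions are checked on their
    values at real points. *)

Definition Jmx (K : pzRingType) n : 'M[K]_(n + n) := block_mx 0 1%:M (- 1%:M) 0.

Lemma mul_Jmx (K : pzRingType) k l n (P Q : 'M[K]_(k, n)) (P' Q' : 'M[K]_(l, n)) :
  row_mx P Q *m Jmx K n *m (row_mx P' Q')^T = P *m Q'^T - Q *m P'^T.
Proof.
rewrite mul_row_block tr_row_mx mul_row_col !mulmx0 !mulmx1 add0r addr0.
by rewrite mulmxN mulmx1 mulNmx addrC.
Qed.

Lemma tr_Jmx (K : pzRingType) n : (Jmx K n)^T = - Jmx K n.
Proof.
by rewrite /Jmx tr_block_mx opp_block_mx !trmx0 !linearN /= trmx1 !oppr0 !opprK.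
Qed.

Lemma Jmx_unit (K : comUnitRingType) n : Jmx K n \in unitmx.
Proof.
have JJ : Jmx K n *m - Jmx K n = 1%:M.
  rewrite /Jmx opp_block_mx mulmx_block !oppr0 !mulmx0 !mul0mx !add0r.
  by rewrite !addr0 opprK mulmx1 mulNmx mulmxN mul1mx opprK -scalar_mx_block.
by case: (mulmx1_unit JJ).
Qed.

(* The Gram matrix of the first 2n vectors; when m < 2n the missing entries are
   taken from J, so that the determinant does not vanish identically. *)
Definition gram_block (K : pzRingType) n m (a : nat -> nat -> K) : 'M[K]_(n + n) :=
  \matrix_(i, j) if (i < m)%N && (j < m)%N then a i j else Jmx K n i j.

(* Zero outside the index range. *)
Definition extend_mx (K : nmodType) m (A : 'M[K]_m) (i j : nat) : K :=
  if insub i is Some i' then if insub j is Some j' then A i' j' else 0 else 0.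

Lemma extend_mx_ord (K : nmodType) m (A : 'M[K]_m) (i j : 'I_m) :
  extend_mx A i j = A i j.
Proof. by rewrite /extend_mx !valK. Qed.

(** Elimination with the pivot [A i j]: the new matrix is a left multiple of A whose columns i and j
    vanish. Its row space thus lies in that of A, inside the kernel of the projection B onto these
    two coordinates. The image of A under B has rank 2, since rows i and j of [A *m B] have
    determinant [c * c]. *)
Lemma alternating_rank2_reduction (K : fieldType) m (A : 'M[K]_m) (i j : 'I_m) :
    (forall k l, A k l = - A l k) -> (forall k, A k k = 0) -> A i j != 0 ->
  (\rank (A - ((A i j)^-1 *: col i A *m (col j A)^T
             - col j A *m ((A i j)^-1 *: col i A)^T))%R + 2 <= \rank A)%N.
Proof.
move=> Aalt A0; set c := A i j; set A' := A - _ => c0.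
have A'E k l : A' k l = A k l + c^-1 * (A k j * A l i - A k i * A l j).
  rewrite !mxE !big_ord1 !mxE; congr (_ + _).
  rewrite -/c mulrBr opprB; congr (_ - _); last by rewrite mulrA.
  by rewrite mulrCA.
pose f (a : 'I_2) := if a == 0 then i else j.
pose B : 'M[K]_(m, 2) := (rowsub f 1%:M)^T.
have MB k (M : 'M[K]_(k, m)) a b : (M *m B) a b = M a (f b).
  rewrite mxE (bigD1 (f b)) //= !mxE eqxx mulr1 big1 ?addr0 // => l /negPf nl.
  by rewrite !mxE eq_sym nl mulr0.
rewrite -(mxrank_mul_ker A B) addnC leq_add //.
  rewrite -[X in (X <= _)%N](@mxrank_unit _ _ (rowsub f 1%:M *m (A *m B))).
    exact: mxrankM_maxr.
  have ->: rowsub f 1%:M *m (A *m B) = \matrix_(a, b) A (f a) (f b).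
    by rewrite mul_rowsub_mx mul1mx; apply/matrixP=> a b; rewrite mxE MB [RHS]mxE.
  rewrite unitmxE (expand_det_row _ 0) !big_ord_recl big_ord0 /cofactor !det_mx11.
  rewrite !mxE /f /= !A0 [A j i]Aalt -/c unitfE.
  have ->: 0 * ((-1) ^+ (0 + 0) * 0) + (c * ((-1) ^+ (0 + 1) * - c) + 0) = c * c.
    by ring.
  by rewrite mulf_neq0.
apply: mxrankS; rewrite sub_capmx; apply/andP; split.
  apply/submxP; exists (1%:M + c^-1 *:
    (\matrix_(k, l) (A k i * (l == j)%:R - A k j * (l == i)%:R))).
  apply/matrixP=> k l; rewrite A'E mulmxDl mul1mx -scalemxAl !mxE.
  congr (_ + _ * _); rewrite (eq_bigr (fun r =>
     A k i * ((r == j)%:R * A r l) - A k j * ((r == i)%:R * A r l))).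
    rewrite sumrB -!mulr_sumr.
    rewrite (bigD1 j) //= big1 => [|r /negPf ->]; last by rewrite mul0r.
    rewrite (bigD1 i) //= big1 => [|r /negPf ->]; last by rewrite mul0r.
    rewrite !eqxx !mul1r !addr0 [A l i]Aalt [A l j]Aalt !mulrN opprK.
    by rewrite addrC.
  by move=> r _; rewrite !mxE mulrBl !mulrA.
apply/sub_kermxP/matrixP => k b; rewrite MB A'E mxE /f.
case: ifP => _; first by rewrite A0 mulr0 sub0r -/c mulrN mulrCA mulVf // mulr1 subrr.
by rewrite A0 mulr0 subr0 [A j i]Aalt -/c mulrN mulrN mulrCA mulVf // mulr1 subrr.
Qed.

Section Decomposition.
Variables (K : fieldType) (E : divringClosed K).

(** Each rank-two reduction splits off one hyperbolic plane, contributing one column to p and one to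
    q. Only field operations on the entries of A occur, so X stays over E. *)
Lemma alternating_decomposition n m (A : 'M[K]_m) :
    (forall k l, A k l = - A l k) -> (forall k, A k k = 0) ->
    A \is a mxOver E -> (\rank A <= n + n)%N ->
  exists2 X : 'M[K]_(m, n + n), X \is a mxOver E & X *m Jmx K n *m X^T = A.
Proof.
move=> Aalt A0 AE rA.
suff [p [q [pE qE ->]]] : exists p q : 'M[K]_(m, n),
    [/\ p \is a mxOver E, q \is a mxOver E & A = p *m q^T - q *m p^T].
  exists (row_mx p q); last by rewrite mul_Jmx.
  apply/mxOverP=> i j; rewrite !mxE.
  by case: splitP => k _; [apply: (mxOverP pE)|apply: (mxOverP qE)].
elim: n A Aalt A0 AE rA => [|n IHn] A Aalt A0 AE rA.
  exists 0, 0; rewrite !rpred0; split=> //.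
  by rewrite !mul0mx subr0; apply/eqP; rewrite -mxrank_eq0 -leqn0.
have [->|] := eqVneq A 0.
  by exists 0, 0; rewrite !rpred0; split=> //; rewrite !mul0mx subr0.
move=> An0; have [[i j] /= c0] : exists ij, A ij.1 ij.2 != 0.
  apply/existsP; apply: contra_neqT An0 => /existsPn A00.
  by apply/matrixP=> i j; rewrite mxE; have /negPn/eqP := A00 (i, j).
have := alternating_rank2_reduction Aalt A0 c0.
set p := _ *: _; set q := col j A; set A' := A - _ => /= rA'.
have A'E k l : A' k l =
    A k l - ((A i j)^-1 * A k i * A l j - A k j * ((A i j)^-1 * A l i)).
  by rewrite !mxE !big_ord1 !mxE.
have colE k : col k A \is a mxOver E.
  by apply/mxOverP=> a b; rewrite mxE (mxOverP AE).
have pE : p \is a mxOver E by rewrite mxOverZ // rpredV (mxOverP AE).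
have trE k l (M : 'M[K]_(k, l)) : M \is a mxOver E -> M^T \is a mxOver E.
  by move=> ME; apply/mxOverP=> a b; rewrite mxE (mxOverP ME).
have [k l|k|||p' [q' [p'E q'E A'pq]]] := IHn A'.
- by rewrite !A'E (Aalt l k); ring.
- by rewrite A'E A0; ring.
- by rewrite !rpredB // mxOverM ?trE ?colE.
- by rewrite -(leq_add2r 2) (leq_trans rA') // (leq_trans rA) // !addSn addnS addn2.
have main : A = row_mx p p' *m (row_mx q q')^T - row_mx q q' *m (row_mx p p')^T.
  by rewrite !tr_row_mx !mul_row_col opprD addrACA -A'pq /A' addrC subrK.
exists (row_mx p p'), (row_mx q q'); split; last exact: main.
  apply/mxOverP=> a b; rewrite mxE.
  by case: splitP => r _; [apply: (mxOverP pE)|apply: (mxOverP p'E)].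
apply/mxOverP=> a b; rewrite mxE.
by case: splitP => r _; [apply: (mxOverP (colE _))|apply: (mxOverP q'E)].
Qed.

Lemma mxOver_det n (A : 'M[K]_n) : A \is a mxOver E -> \det A \in E.
Proof.
move=> /mxOverP AE; apply: rpred_sum => s _.
by rewrite rpredMsign rpred_prod.
Qed.

Lemma mxOver_invmx n (A : 'M[K]_n) : A \is a mxOver E -> invmx A \is a mxOver E.
Proof.
move=> AE; rewrite /invmx; case: ifP => // _.
rewrite mxOverZ ?rpredV ?mxOver_det //; apply/mxOverP=> i j.
rewrite mxE rpredMsign mxOver_det //; apply/mxOverP=> k l.
by rewrite !mxE (mxOverP AE).
Qed.

Lemma Jmx_alt n : (forall i j, Jmx K n i j = - Jmx K n j i) /\
  (forall i, Jmx K n i i = 0).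
Proof.
split=> [i j|i].
  by have /matrixP/(_ j i) := tr_Jmx K n; rewrite !mxE.
rewrite -(splitK i); case: (split i) => k /=.
  by rewrite block_mxEul mxE.
by rewrite block_mxEdr mxE.
Qed.

(** The rows of X below 2n come from a decomposition X0 of the invertible block, and each further
    row solves a linear system with matrix built from X0. The indices of [a] are natural numbers
    because the padded block may be larger than m; surplus rows of X0 are dropped. *)
Lemma gram_realization n m (a : nat -> nat -> K) :
    (forall i j, a i j = - a j i) -> (forall i, a i i = 0) ->
    (forall i j, (i < m)%N -> (j < m)%N -> (i < n + n)%N -> a i j \in E) ->
    \det (gram_block n m a) != 0 ->
  exists X : 'M[K]_(m, n + n), [/\ X \is a mxOver E,
    forall i j : 'I_m, (i < n + n)%N -> (X *m Jmx K n *m X^T) i j = a i j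
    & row_free (rowsub (widen_ord (geq_minl m (n + n))) X)].
Proof.
move=> aalt a0 aE detB; set B := gram_block n m a in detB.
have [Jalt J0] := Jmx_alt n.
have JE : Jmx K n \is a mxOver E.
  apply/mxOverP=> i j; rewrite !mxE.
  by case: splitP => ? _; rewrite !mxE; case: splitP => ? _;
    rewrite !mxE ?rpred0 ?rpredN // rpred_nat.
have BE k l : B k l = if (k < m)%N && (l < m)%N then a k l else Jmx K n k l.
  by rewrite mxE.
have [k l|k|||X0 X0E X0B] := @alternating_decomposition n _ B.
- by rewrite !BE [in RHS]andbC; case: ifP.
- by rewrite BE; case: ifP.
- apply/mxOverP=> k l; rewrite BE; case: ifP => [/andP[km lm]|_].
    exact: aE.
  exact: (mxOverP JE).
- exact: rank_leq_row.
have Bu : B \in unitmx by rewrite unitmxE unitfE.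
have X0u : X0 *m Jmx K n \in unitmx /\ X0^T \in unitmx.
  by apply/andP; rewrite -unitmx_mul X0B.
have X0T : X0 \in unitmx by rewrite -unitmx_tr; case: X0u.
have JX0 : Jmx K n *m X0^T \in unitmx by rewrite unitmx_mul Jmx_unit; case: X0u.
(* A vector is determined by its products with the basis of rows of X0. *)
pose Y := (\matrix_(j < m, i < n + n) a j i) *m invmx (Jmx K n *m X0^T).
pose X := \matrix_(j < m, i < n + n)
  if insub (j : nat) is Some j' then X0 j' i else Y j i.
have rowX (j : 'I_m) (jN : (j < n + n)%N) : row j X = row (Ordinal jN) X0.
  by apply/rowP=> i; rewrite !mxE insubT.
have rowY (j : 'I_m) : (n + n <= j)%N -> row j X = row j Y.
  by move=> jN; apply/rowP=> i; rewrite !mxE insubF // ltnNge jN.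
have entry k l (P : 'M[K]_(k, n + n)) (Q : 'M[K]_(l, n + n)) i j :
    (P *m Jmx K n *m Q^T) i j = (row i P *m Jmx K n *m (row j Q)^T) 0 0.
  rewrite -row_mul mxE [RHS]mxE; apply: eq_bigr => r _.
  by congr (_ * _); rewrite [RHS]mxE // mxE [RHS]mxE.
exists X; split.
- apply/mxOverP=> j i; rewrite mxE; case: insubP => [j' _ _|jN].
    exact: (mxOverP X0E).
  rewrite -leqNgt in jN; rewrite mxE rpred_sum // => l _; rewrite !mxE.
  have lm : (l < m)%N.
    by rewrite (leq_ltn_trans _ (ltn_ord j)) // (leq_trans _ jN) // ltnW.
  rewrite rpredM //; first by rewrite aalt rpredN aE.
  apply: (mxOverP (mxOver_invmx (mxOverM JE _))).
  by apply/mxOverP=> ? ?; rewrite mxE (mxOverP X0E).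
- move=> i j iN; rewrite entry rowX; case: (ltnP j (n + n)) => jN.
    by rewrite rowX -entry X0B mxE /= !ltn_ord.
  (* By antisymmetry [X0 *m J *m Y^T] is minus the transpose of [Y *m J *m X0^T], whose entries are
     the prescribed [a j i]. *)
  rewrite rowY // -entry -[_ *m _]trmxK mxE trmx_mul trmxK trmx_mul.
  rewrite tr_Jmx mulNmx mulmxN mulmxKV // mxE mxE /=.
  by rewrite -aalt.
- have ->: rowsub (widen_ord (geq_minl m (n + n))) X =
           rowsub (widen_ord (geq_minr m (n + n))) X0.
    apply/row_matrixP=> i; rewrite !row_rowsub rowX; last first.
      by move=> h; congr row; apply: val_inj.
    by rewrite /= (leq_trans (ltn_ord i) (geq_minr _ _)).
  rewrite -[X0]mul1mx -mul_rowsub_mx /row_free mxrankMfree; last first.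
    by rewrite row_free_unit.
  rewrite -/(row_free _); apply/row_freeP.
  exists (rowsub (widen_ord (geq_minr m (n + n))) 1%:M)^T.
  apply/matrixP=> i j; rewrite !mxE (bigD1 (widen_ord (geq_minr m (n + n)) i)) //=.
  rewrite !mxE eqxx mul1r big1 ?addr0 => [|l /negPf nl]; last first.
    by rewrite !mxE eq_sym nl mul0r.
  by rewrite -!val_eqE /= eq_sym.
Qed.

Lemma gram_realization_mx n m (A : 'M[K]_m) :
    (forall i j, A i j = - A j i) -> (forall i, A i i = 0) ->
    (forall i j : 'I_m, (i < n + n)%N -> A i j \in E) ->
    \det (gram_block n m (extend_mx A)) != 0 ->
  exists X : 'M[K]_(m, n + n), [/\ X \is a mxOver E,
    forall i j : 'I_m, (i < n + n)%N -> (X *m Jmx K n *m X^T) i j = A i j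
    & row_free (rowsub (widen_ord (geq_minl m (n + n))) X)].
Proof.
move=> Aalt A0 AE detB.
have [i j|i|i j im jm iN||X [XE XA Xfree]] :=
    @gram_realization n m (extend_mx A) => //.
- rewrite /extend_mx; case: insubP => [i' _ _|_]; case: insubP => [j' _ _|_];
    by rewrite ?oppr0.
- by rewrite /extend_mx; case: insubP.
- by rewrite (extend_mx_ord A (Ordinal im) (Ordinal jm)) AE.
by exists X; split=> // i j iN; rewrite XA // extend_mx_ord.
Qed.

End Decomposition.

(** * Witt extension *)

Section Witt.
Variables (K : realFieldType) (n : nat).
Local Notation J := (Jmx K n).

Lemma alt_form0 (w : 'rV[K]_(n + n)) : w *m J *m w^T = 0.
Proof.
apply/matrixP=> i j; rewrite !ord1 [RHS]mxE.
have /matrixP/(_ 0 0) : (w *m J *m w^T)^T = - (w *m J *m w^T).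
  by rewrite trmx_mul trmxK trmx_mul tr_Jmx mulNmx mulmxN mulmxA.
by rewrite mxE [RHS]mxE => e; lra.
Qed.

(** For w outside the span of V, the vectors w' with the required products form a coset of the
    orthogonal of X; the point is to find one outside the span of X. The product of w' with itself
    imposes nothing, as the form is alternating. The spans may be degenerate. *)
Lemma witt_step k (c : K) (V X : 'M[K]_(k, n + n)) :
    c != 0 -> (k < n + n)%N -> row_free V -> row_free X ->
    X *m J *m X^T = c *: (V *m J *m V^T) ->
  exists w w' : 'rV[K]_(n + n), [/\ row_free (col_mx V w), row_free (col_mx X w') &
    w' *m J *m X^T = c *: (w *m J *m V^T)].
Proof.
move=> c0 kn Vfree Xfree VX.
have extend (Z : 'M[K]_(k, n + n)) (w : 'rV_(n + n)) :
    row_free Z -> ~~ (w <= Z)%MS -> row_free (col_mx Z w).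
  move=> Zfree wZ; rewrite /row_free eqn_leq rank_leq_row /=.
  have : (\rank Z < \rank (Z + w)%MS)%N.
    by apply: rank_ltmx; rewrite /ltmx addsmxSl addsmx_sub submx_refl.
  by rewrite (eqP Zfree) addsmxE; apply: leq_trans; rewrite addn1.
have [w wV] : exists w : 'rV_(n + n), ~~ (w <= V)%MS.
  have : ~~ row_full V by rewrite /row_full (eqP Vfree) ltn_eqF.
  by rewrite -sub1mx => /row_subPn[i]; exists (row i 1%:M).
have full (Z : 'M[K]_(k, n + n)) : row_free Z -> row_full (J *m Z^T).
  move=> Zfree; rewrite /row_full eqmxMfull ?row_full_unit ?Jmx_unit //.
  by rewrite mxrank_tr.
pose s := (c *: (w *m J *m V^T)) *m pinvmx (J *m X^T).
have sX : s *m J *m X^T = c *: (w *m J *m V^T).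
  by rewrite -mulmxA mulmxKpV // submx_full ?full.
have [/existsP[z zX]|] := boolP [exists i : 'I_(n + n),
    ~~ ((s + row i (kermx (J *m X^T)))%R <= X)%MS].
  exists w, (s + row z (kermx (J *m X^T)));
  split; [exact: (extend _ _ Vfree wV)|exact: (extend _ _ Xfree zX)|].
  rewrite 2!mulmxDl sX -[_ *m J *m X^T in X in _ + X]mulmxA -row_mul mulmx_ker row0.
  by rewrite addr0.
(* If every solution w' lay in the span of X, this span would contain its own
   orthogonal; by the equality of Gram ranks the same would hold for V, which
   would force w into the span of V. *)
move=> /existsPn /= noX.
have [sXX|sX'] := boolP (s <= X)%MS; last first.
  by exists w, s; split; [exact: (extend _ _ Vfree wV)|exact: (extend _ _ Xfree sX')|].
have kerX : (kermx (J *m X^T) <= X)%MS.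
  apply/row_subP=> i; have /negPn := noX i.
  have sN : (- s <= X)%MS by rewrite eqmx_opp.
  by move=> h; have := addmx_sub h sN; rewrite addrAC subrr add0r.
have rank_ker (Z : 'M[K]_(k, n + n)) : row_free Z ->
    \rank (kermx (J *m Z^T)) = (n + n - k)%N.
  by move=> Zfree; rewrite mxrank_ker; have /eqP -> := full _ Zfree.
have rank_cap (Z : 'M[K]_(k, n + n)) : row_free Z ->
    (\rank (Z *m J *m Z^T) + \rank (Z :&: kermx (J *m Z^T)) = k)%N.
  by move=> Zfree; rewrite -mulmxA mxrank_mul_ker (eqP Zfree).
have kerV : (kermx (J *m V^T) <= V)%MS.
  have : (\rank (V :&: kermx (J *m V^T)) = \rank (kermx (J *m V^T)))%N.
    have := rank_cap _ Vfree; have := rank_cap _ Xfree.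
    rewrite VX mxrank_scale_nz // (capmx_idPr kerX) !rank_ker //.
    by lia.
  move=> /eqP; rewrite (mxrank_leqif_eq (capmxSr _ _)) => /eqmxP e.
  by apply: submx_trans (capmxSl _ (kermx (J *m V^T))); rewrite e submx_refl.
have [d sd] := submxP sXX.
case/negP: wV; rewrite -[w](subrK (d *m V)).
apply: addmx_sub; last by rewrite submxMl.
apply: submx_trans kerV; apply/sub_kermxP.
rewrite mulmxA 2!mulmxBl -!mulmxA [V *m _]mulmxA.
apply/eqP; rewrite subr_eq0; apply/eqP/(scalerI c0).
rewrite mulmxA -sX sd -!mulmxA [X *m _]mulmxA VX -scalemxAr.
by rewrite !mulmxA.
Qed.

(** Vectors are added one at a time until V and X are bases; then g is [invmx V *m X]. *)
Lemma witt_extension k (c : K) (V X : 'M[K]_(k, n + n)) :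
    c != 0 -> row_free V -> row_free X ->
    X *m J *m X^T = c *: (V *m J *m V^T) ->
  exists2 g : 'M[K]_(n + n), g *m J *m g^T = c *: J & V *m g = X.
Proof.
move=> c0; have [d] := ubnP (n + n - k)%N; elim: d => // d IHd in k V X *.
move=> kd Vfree Xfree VX.
have kn : (k <= n + n)%N by rewrite -(eqP Vfree) rank_leq_col.
have [{kd IHd}kn'|kltn] := leqP (n + n) k.
  have ek : k = (n + n)%N by apply/eqP; rewrite eqn_leq kn.
  subst k; rewrite row_free_unit in Vfree.
  exists (invmx V *m X); last by rewrite mulKVmx.
  rewrite trmx_mul -!mulmxA [J *m _]mulmxA [X *m _]mulmxA [X *m _]mulmxA VX.
  rewrite -scalemxAl -scalemxAr -!mulmxA -trmx_mul mulVmx // trmx1 mulmx1.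
  by rewrite mulKmx.
have [w [w' [Vw Xw' ww']]] := witt_step c0 kltn Vfree Xfree VX.
have [||||g gJ] := IHd _ (col_mx V w) (col_mx X w') => //.
- by lia.
- rewrite !mul_col_mx !tr_col_mx !mul_mx_row VX !alt_form0 ww'.
  have flip (a : 'rV[K]_(n + n)) (b : 'M_(k, n + n)) :
      b *m J *m a^T = - (a *m J *m b^T)^T.
    by rewrite trmx_mul trmxK trmx_mul tr_Jmx mulNmx mulmxN opprK mulmxA.
  rewrite [X *m J *m _]flip [V *m J *m w^T]flip ww' linearZ /=.
  apply/matrixP=> i j; rewrite !mxE.
  case: (split i) => i'; rewrite !mxE; case: (split j) => j'; rewrite !mxE ?mulr0 //.
  by rewrite mulrN.
by rewrite mul_col_mx => /eq_col_mx[Vg _]; exists g.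
Qed.

End Witt.

(** * Evaluation of rational functions *)

Lemma poly_eq0_above (K : realFieldType) (q : {poly K}) (c : K) :
  (forall t, c < t -> q.[t] = 0) -> q = 0.
Proof.
move=> q0; apply: (@roots_geq_poly_eq0 _ q [seq c + i.+1%:R | i <- iota 0 (size q)]).
- by apply/allP=> _ /mapP[i _ ->]; apply/eqP/q0; rewrite ltrDl ltr0n.
- rewrite map_inj_uniq ?iota_uniq // => i j /addrI/eqP.
  by rewrite eqr_nat eqSS => /eqP.
- by rewrite size_map size_iota.
Qed.

Lemma digits_inj n B (a b : 'I_n -> nat) :
    (forall i, (a i < B)%N) -> (forall i, (b i < B)%N) ->
    (\sum_(i < n) a i * B ^ i = \sum_(i < n) b i * B ^ i)%N -> a =1 b.
Proof.
elim: n a b => [|n IHn] a b aB bB; first by move=> _ [].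
have step (d : 'I_n.+1 -> nat) :
    (\sum_(i < n.+1) d i * B ^ i = d ord0 + (\sum_(i < n) d (lift ord0 i) * B ^ i) * B)%N.
  rewrite big_ord_recl expn0 muln1 big_distrl /=; congr (_ + _)%N.
  by apply: eq_bigr => i _; rewrite /bump add1n expnSr mulnA.
have Bgt0 : (0 < B)%N by apply: leq_ltn_trans (aB ord0).
rewrite !step => e.
have e0 : a ord0 = b ord0.
  have := congr1 (modn^~ B) e.
  by rewrite ![(_ + _ * B)%N]addnC !modnMDl !modn_small.
move/eqP: e; rewrite e0 eqn_add2l eqn_pmul2r // => /eqP/IHn e1 i.
case: (unliftP ord0 i) => [j|] -> //.
by apply: e1 => k; [apply: aB|apply: bB].
Qed.

(* Kronecker substitution X_i := X^(B^i), with B larger than all exponents. *)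
Lemma mpoly_eq0 (K : realFieldType) n (p : {mpoly K[n]}) :
  (forall v, p.@[v] = 0) -> p = 0.
Proof.
move=> p0; pose B := msize p.
pose k (x : 'X_{1..n}) := (\sum_(i < n) x i * B ^ i)%N.
pose q : {poly K} := \sum_(x <- msupp p) p@_x *: 'X^(k x).
have q0 : q = 0.
  apply: (@poly_eq0_above _ _ 0) => t _.
  rewrite -[RHS](p0 (fun i => t ^+ (B ^ i))) mevalE /q horner_sum.
  apply: eq_bigr => x _; rewrite hornerZ hornerXn; congr (_ * _).
  by rewrite /k expr_sum; apply: eq_bigr => i _; rewrite -exprM mulnC.
apply/mpolyP => x; rewrite mcoeff0.
have [xp|/memN_msupp_eq0 //] := boolP (x \in msupp p).
have := congr1 (fun r : {poly K} => r`_(k x)) q0.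
rewrite /q coef0 coef_sum (bigD1_seq x) ?msupp_uniq //= coefZ coefXn eqxx mulr1.
rewrite big_seq_cond big1 ?addr0 // => y /andP[yp yx].
rewrite coefZ coefXn; case: eqP => [e|]; last by rewrite mulr0.
have small z i : z \in msupp p -> (z i < B)%N.
  move=> /msize_mdeg_lt; apply: leq_ltn_trans.
  by rewrite mdegE (bigD1 i) //= leq_addr.
case/eqP: yx; apply/mnmP => i.
by apply: (@digits_inj _ B) => [j|j|]; rewrite ?small.
Qed.

Lemma mpoly_eval_inj (K : realFieldType) n (p q : {mpoly K[n]}) :
  (forall v, p.@[v] = q.@[v]) -> p = q.
Proof.
move=> pq; apply/eqP; rewrite -subr_eq0; apply/eqP/mpoly_eq0 => v.
by rewrite mevalB pq subrr.
Qed.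

Lemma mpoly_neq0 (K : realFieldType) n (p : {mpoly K[n]}) v : p.@[v] != 0 -> p != 0.
Proof. by apply: contraNneq => ->; rewrite meval0. Qed.

Lemma mulr_repr_denom (D : idomainType) (f : {fraction D}) :
  f * (\d_(repr f))%:F = (\n_(repr f))%:F.
Proof.
rewrite -{1}[f]reprK; set x := repr f.
rewrite !piE; apply/eqmodP.
rewrite /= FracField.equivfE /FracField.mulf !numden_Ratio ?mulr1 ?oner_eq0 //;
  [by rewrite mulrC|exact: denom_ratioP|exact: denom_ratioP].
Qed.

Lemma frac_reprE (D : idomainType) (f : {fraction D}) :
  f = (\n_(repr f))%:F / (\d_(repr f))%:F.
Proof.
by rewrite -mulr_repr_denom mulfK // tofrac_eq0 denom_ratioP.
Qed.

Section Specialization.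
Variables (K : realFieldType) (N : nat).
Local Notation L := {fraction {mpoly K[N]}}.
Implicit Types (v : 'I_N -> K) (f : L).

(* f is regular at v, with value c. *)
Definition specializes v f (c : K) := exists a b : {mpoly K[N]},
  [/\ b.@[v] != 0, f * b%:F = a%:F & a.@[v] = c * b.@[v]].

Lemma specializes_tofrac v (p : {mpoly K[N]}) : specializes v p%:F p.@[v].
Proof. by exists p, 1; rewrite !rmorph1 oner_neq0 !mulr1. Qed.

Lemma specializesD v f f' c c' :
  specializes v f c -> specializes v f' c' -> specializes v (f + f') (c + c').
Proof.
move=> [a [b [b0 fb ac]]] [a' [b' [b'0 fb' ac']]].
exists (a * b' + a' * b), (b * b'); split.
- by rewrite mevalM mulf_neq0.
- by rewrite !(rmorphM, rmorphD) /= -fb -fb'; ring.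
- by rewrite !(mevalM, mevalD) ac ac'; ring.
Qed.

Lemma specializesM v f f' c c' :
  specializes v f c -> specializes v f' c' -> specializes v (f * f') (c * c').
Proof.
move=> [a [b [b0 fb ac]]] [a' [b' [b'0 fb' ac']]].
exists (a * a'), (b * b'); split.
- by rewrite mevalM mulf_neq0.
- by rewrite !rmorphM /= -fb -fb'; ring.
- by rewrite !mevalM ac ac'; ring.
Qed.

Lemma specializesV v f c : c != 0 -> specializes v f c -> specializes v f^-1 c^-1.
Proof.
move=> c0 [a [b [b0 fb ac]]]; exists b, a.
have a0 : a.@[v] != 0 by rewrite ac mulf_neq0.
have f0 : f != 0.
  apply: contraNneq (mpoly_neq0 a0) => f0.
  by rewrite -tofrac_eq0 -fb f0 mul0r.
split=> //; first by rewrite -fb mulKf.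
by rewrite ac mulKf.
Qed.

Lemma specializesN v f c : specializes v f c -> specializes v (- f) (- c).
Proof.
move=> [a [b [b0 fb ac]]]; exists (- a), b.
by rewrite !mulNr fb mevalN ac rmorphN.
Qed.

Lemma specializes0 v : specializes v 0 0.
Proof. by have := specializes_tofrac v 0; rewrite !rmorph0. Qed.

Lemma specializes1 v : specializes v 1 1.
Proof. by have := specializes_tofrac v 1; rewrite !rmorph1. Qed.

Lemma specializes_sum v (I : Type) (r : seq I) (F : I -> L) (G : I -> K) :
  (forall i, specializes v (F i) (G i)) ->
  specializes v (\sum_(i <- r) F i) (\sum_(i <- r) G i).
Proof.
move=> FG; apply: (big_ind2 (fun x y => specializes v x y)) => //.
  exact: specializes0.
by move=> *; apply: specializesD.
Qed.

Lemma specializes_prod v (I : Type) (r : seq I) (F : I -> L) (G : I -> K) :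
  (forall i, specializes v (F i) (G i)) ->
  specializes v (\prod_(i <- r) F i) (\prod_(i <- r) G i).
Proof.
move=> FG; apply: (big_ind2 (fun x y => specializes v x y)) => //.
  exact: specializes1.
by move=> *; apply: specializesM.
Qed.

Lemma specializesX v f c k : specializes v f c -> specializes v (f ^+ k) (c ^+ k).
Proof.
move=> fc; elim: k => [|k IHk]; first exact: specializes1.
by rewrite !exprS; apply: specializesM.
Qed.

Lemma specializes_mmap v k (p : {mpoly K[k]}) (h : 'I_k -> L) (y : 'I_k -> K) :
  (forall i, specializes v (h i) (y i)) ->
  specializes v (mmap ((@tofrac _) \o (@mpolyC N K)) h p) p.@[y].
Proof.
move=> hy; rewrite /meval /mmap; apply: specializes_sum => x.
apply: specializesM; last first.
  by apply: specializes_prod => i; apply: specializesX.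
by rewrite /= -{2}[p@_x](mevalC v); apply: specializes_tofrac.
Qed.

Lemma specializes_det v k (A : 'M[L]_k) (B : 'M[K]_k) :
  (forall i j, specializes v (A i j) (B i j)) -> specializes v (\det A) (\det B).
Proof.
move=> AB; apply: specializes_sum => s; apply: specializesM.
  apply: specializesX; apply: specializesN; exact: specializes1.
by apply: specializes_prod.
Qed.

(** Together with the closure rules this makes [specializes] a partial evaluation map, so that
    identities in the fraction field pass to values. *)
Lemma specializes_uniq v f c c' : specializes v f c -> specializes v f c' -> c = c'.
Proof.
move=> [a [b [b0 fb ac]]] [a' [b' [b'0 fb' ac']]].
have : a * b' = a' * b.
  by apply/eqP; rewrite -tofrac_eq !rmorphM /= -fb -fb'; apply/eqP; ring.
move=> /(congr1 (meval v)); rewrite !mevalM ac ac' mulrAC -!mulrA => e.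
exact: (mulIf (mulf_neq0 b'0 b0)).
Qed.

Lemma specializes_neq0 v f c : c != 0 -> specializes v f c -> f != 0.
Proof.
move=> c0 fc; apply: contraNneq c0 => f0; rewrite f0 in fc.
by apply/eqP/(specializes_uniq fc)/specializes0.
Qed.

Lemma common_domain k (h : 'I_k -> L) : exists2 D : {mpoly K[N]}, D != 0 &
  forall v, D.@[v] != 0 -> forall i, exists c, specializes v (h i) c.
Proof.
exists (\prod_i \d_(repr (h i))).
  by apply/prodf_neq0 => i _; apply: denom_ratioP.
move=> v Dv i; have dv : (\d_(repr (h i))).@[v] != 0.
  by apply: contraNneq Dv => d0; rewrite (bigD1 i) //= mevalM d0 mul0r.
exists ((\n_(repr (h i))).@[v] / (\d_(repr (h i))).@[v]).
rewrite {1}[h i]frac_reprE; apply: specializesM; first exact: specializes_tofrac.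
by apply: specializesV => //; apply: specializes_tofrac.
Qed.

End Specialization.

(** * The action on points *)

Section Contact.
Variables (R : realType) (n m : nat).
Local Notation J := (Jmx R n).
Local Notation point := 'M[R]_(m, n + n + 1).
Implicit Types (P Q : point) (g : 'M[R]_(n + n)) (lam : R).

Lemma omegaE (v w : 'rV[R]_(n + n)) : omega v w = (v *m J *m w^T) 0 0.
Proof.
rewrite -[in RHS](hsubmxK v) -[in RHS](hsubmxK w) mul_Jmx /omega /dot.
rewrite [RHS]mxE [X in _ = X + _]mxE [X in _ = _ + X]mxE [X in _ = _ - X]mxE.
by congr (_ - _); apply: eq_bigr => k _; rewrite [X in _ = _ * X]mxE // mulrC.
Qed.

Lemma in_CSpP g lam : in_CSp g lam <-> 0 < lam /\ g *m J *m g^T = lam *: J.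
Proof.
have formE (v w : 'rV[R]_(n + n)) :
    omega (v *m g) (w *m g) = (v *m (g *m J *m g^T) *m w^T) 0 0.
  by rewrite omegaE trmx_mul !mulmxA.
split=> -[lam0 gJ]; split=> //; last first.
  by move=> v w; rewrite formE omegaE gJ -scalemxAr -scalemxAl mxE.
apply/matrixP=> i j; have := gJ (row i 1%:M) (row j 1%:M).
rewrite formE omegaE -!(row_mul i 1%:M) !mul1mx.
have entry (A : 'M[R]_(n + n)) : (row i A *m (row j 1%:M)^T) 0 0 = A i j.
  rewrite tr_row trmx1 -row_mul -[in RHS](mulmx1 A) !mxE.
  by apply: eq_bigr => k _; rewrite !mxE.
by rewrite !entry => ->; rewrite [RHS]mxE.
Qed.

Lemma CSp_unit g lam : in_CSp g lam -> g \in unitmx.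
Proof.
move=> /in_CSpP[lam0 gJ]; have : g *m J *m g^T \in unitmx.
  by rewrite gJ unitmxZ ?Jmx_unit // unitfE gt_eqF.
by rewrite !unitmx_mul => /andP[/andP[]].
Qed.

Definition coords P : 'I_(nvars n m) -> R := fun i => mxvec P 0 i.

Lemma coords_surj (v : 'I_(nvars n m) -> R) : exists P, coords P =1 v.
Proof.
by exists (vec_mx (\row_i v i)) => i; rewrite /coords vec_mxK mxE.
Qed.

Lemma poly_ext (p q : {mpoly R[nvars n m]}) :
  (forall P, p.@[coords P] = q.@[coords P]) -> p = q.
Proof.
move=> pq; apply: mpoly_eval_inj => v; have [P Pv] := coords_surj v.
by rewrite -!(meval_eq _ Pv).
Qed.

Definition halfform (S : comNzRingType) (v : 'rV[S]_(n + n)) := dot (lsubmx v) (rsubmx v).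
Definition height P k : R := P k (rshift (n + n) 0).
(* The real values of R_k (radial) and R_ij (gram). *)
Definition radial P k : R := halfform (row k (lsubmx P)) - 2 * height P k.
Definition gram P : 'M[R]_m := lsubmx P *m J *m (lsubmx P)^T.

Definition real_act g lam P : point := row_mx (lsubmx P *m g)
  (\col_k (lam * (height P k - 2^-1 * halfform (row k (lsubmx P)))
           + 2^-1 * halfform (row k (lsubmx P *m g)))).

Lemma gramE P i j : gram P i j = omega (row i (lsubmx P)) (row j (lsubmx P)).
Proof.
rewrite omegaE /gram tr_row -row_mul [LHS]mxE [RHS]mxE.
by apply: eq_bigr => k _; rewrite [in RHS]mxE [X in _ = _ * X]mxE.
Qed.

Section Naturality.
Variables (S : comAlgType R) (phi : {rmorphism S -> R}).
Hypothesis phiZ : forall a x, phi (a *: x) = a * phi x.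

Lemma map_dot (a b : 'rV[S]_n) : phi (dot a b) = dot (map_mx phi a) (map_mx phi b).
Proof.
by rewrite /dot rmorph_sum; apply: eq_bigr => k _; rewrite rmorphM !mxE.
Qed.

Lemma map_act_row g (v : 'rV[S]_(n + n)) :
  map_mx phi (v *m map_mx (in_alg S) g) = map_mx phi v *m g.
Proof.
rewrite map_mxM; congr (_ *m _); apply/matrixP=> i j.
by rewrite !mxE /= phiZ rmorph1 mulr1.
Qed.

(** The action is given by formulas valid over every commutative algebra, hence commutes with
    algebra morphisms. Evaluating the generic point at P then identifies [pull_poly] with
    composition by [real_act]. *)
Lemma map_diag_act g lam (G : 'M[S]_(m, n + n + 1)) :
  map_mx phi (diag_act g lam G) = real_act g lam (map_mx phi G).
Proof.
have rowG k : map_mx phi (lsubmx (row k G)) = row k (lsubmx (map_mx phi G)).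
  by apply/rowP=> j; rewrite !mxE.
apply/matrixP=> k j; rewrite mxE /diag_act mxE /contact_act.
rewrite -[j]splitK; case: (split j) => j' /=.
  rewrite !row_mxEl.
  have /rowP/(_ j') := map_act_row g (pt_v (row k G)); rewrite mxE => ->.
  by rewrite /pt_v rowG -row_mul mxE.
have uE : phi (pt_u (row k G)) = height (map_mx phi G) k.
  by rewrite /pt_u /height !mxE.
have formE v : phi (dot (lsubmx v) (rsubmx v)) = halfform (map_mx phi v).
  by rewrite map_dot /halfform map_lsubmx map_rsubmx.
rewrite !row_mxEr mxE [RHS]mxE rmorphD !phiZ rmorphB phiZ.
by rewrite /pt_x /pt_y !formE map_act_row uE /pt_v rowG -row_mul.
Qed.

Lemma map_radial (G : 'M[S]_(m, n + n + 1)) k :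
  phi (dot (pt_x (row k G)) (pt_y (row k G)) - 2 * pt_u (row k G)) =
  radial (map_mx phi G) k.
Proof.
rewrite rmorphB rmorphM rmorph_nat map_dot /radial /halfform /height.
congr (_ - 2 * _); last by rewrite /pt_u !mxE.
by rewrite /dot; apply: eq_bigr => l _; rewrite /pt_x /pt_y /pt_v !mxE.
Qed.

Lemma map_gram (G : 'M[S]_(m, n + n + 1)) i j :
  phi (dot (pt_x (row i G)) (pt_y (row j G)) - dot (pt_x (row j G)) (pt_y (row i G))) =
  gram (map_mx phi G) i j.
Proof.
rewrite gramE /omega rmorphB !map_dot.
by congr (_ - _); apply: eq_bigr => l _; rewrite /pt_x /pt_y /pt_v !mxE.
Qed.

End Naturality.

Definition evalp P : {rmorphism {mpoly R[nvars n m]} -> R} := meval (coords P).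

Lemma evalp_generic P : map_mx (evalp P) (generic_point R n m) = P.
Proof.
by apply/matrixP=> k j; rewrite !mxE /= mevalXU /coords mxvecE.
Qed.

Lemma eval_pull g lam (p : {mpoly R[nvars n m]}) P :
  (pull_poly g lam p).@[coords P] = p.@[coords (real_act g lam P)].
Proof.
rewrite /pull_poly comp_mpoly_meval; apply: meval_eq => i.
rewrite tnth_mktuple /coords; case/mxvec_indexP: i => k j; rewrite !mxvecE.
have /matrixP/(_ k j) := @map_diag_act _ (evalp P : {rmorphism polyfun R n m -> R})
  (fun a x => mevalZ _ a x) g lam (generic_point R n m).
by rewrite evalp_generic mxE.
Qed.

Lemma eval_Rone P k : (Rone R n k).@[coords P] = radial P k.
Proof.
have := @map_radial _ (evalp P : {rmorphism polyfun R n m -> R}) (generic_point R n m) k.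
by rewrite evalp_generic.
Qed.

Lemma eval_Rtwo P i j : (Rtwo R n i j).@[coords P] = gram P i j.
Proof.
have := @map_gram _ (evalp P : {rmorphism polyfun R n m -> R}) (generic_point R n m) i j.
by rewrite evalp_generic.
Qed.

Lemma lsubmx_act g lam P : lsubmx (real_act g lam P) = lsubmx P *m g.
Proof. by rewrite row_mxKl. Qed.

Lemma height_act g lam P k : height (real_act g lam P) k =
  lam * (height P k - 2^-1 * halfform (row k (lsubmx P)))
  + 2^-1 * halfform (row k (lsubmx P *m g)).
Proof. by rewrite {1}/height row_mxEr mxE. Qed.

Lemma gram_act g lam P : in_CSp g lam -> gram (real_act g lam P) = lam *: gram P.
Proof.
move=> /in_CSpP[_ gJ]; rewrite /gram /real_act row_mxKl trmx_mul !mulmxA.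
rewrite -[lsubmx P *m g *m J]mulmxA -[lsubmx P *m _ *m g^T]mulmxA gJ.
by rewrite -scalemxAr -scalemxAl.
Qed.

(** R_k is -2 times the quantity u - xy/2 that the contact lift multiplies by lam. *)
Lemma radial_act g lam P k : radial (real_act g lam P) k = lam * radial P k.
Proof.
rewrite /radial lsubmx_act height_act.
by field.
Qed.

Lemma real_actK g lam P : g \in unitmx -> lam != 0 ->
  real_act (invmx g) lam^-1 (real_act g lam P) = P.
Proof.
move=> gu lam0; rewrite {1}/real_act lsubmx_act mulmxK //.
rewrite -[RHS]hsubmxK; congr row_mx; apply/matrixP=> k j.
rewrite ord1 mxE [RHS]mxE height_act /height.
by field.
Qed.

Definition top_free P :=
  row_free (rowsub (widen_ord (geq_minl m (n + n))) (lsubmx P)).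

Lemma gram_alt P i j : gram P i j = - gram P j i.
Proof.
have /matrixP/(_ i j) : (gram P)^T = - gram P.
  by rewrite /gram trmx_mul trmxK trmx_mul tr_Jmx mulNmx mulmxN mulmxA.
by rewrite mxE [RHS]mxE => ->; rewrite opprK.
Qed.

(** Witt extension yields g on the first min(m, 2n) vectors. If m > 2n these are bases, and the
    later vectors match because their products with the basis do. Each u_k is then recovered from
    R_k. *)
Lemma same_orbit (c : R) P Q : 0 < c -> top_free P -> top_free Q ->
    (forall i j : 'I_m, (i < n + n)%N -> gram Q i j = c * gram P i j) ->
    (forall k, radial Q k = c * radial P k) ->
  exists2 g, in_CSp g c & real_act g c P = Q.
Proof.
move=> c0 Pfree Qfree gramQ radQ; pose h := widen_ord (geq_minl m (n + n)).
set V := lsubmx P in Pfree *; set X := lsubmx Q in Qfree *.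
have hlt (i : 'I_(minn m (n + n))) : (h i < n + n)%N.
  exact: leq_trans (ltn_ord i) (geq_minr _ _).
have gram_top : X *m J *m (rowsub h X)^T = c *: (V *m J *m (rowsub h V)^T).
  have entry Z : lsubmx Z *m J *m (rowsub h (lsubmx Z))^T = \matrix_(i, j) gram Z i (h j).
    by apply/matrixP=> i j; rewrite [RHS]mxE /gram !mxE; apply: eq_bigr => k _; rewrite !mxE.
  rewrite !entry; apply/matrixP=> i j; rewrite mxE [RHS]mxE [X in _ = c * X]mxE.
  by rewrite gram_alt gramQ // (gram_alt P i) mulrN.
have gramXV : rowsub h X *m J *m (rowsub h X)^T = c *: (rowsub h V *m J *m (rowsub h V)^T).
  by rewrite !mul_rowsub_mx gram_top; apply/matrixP=> i j; rewrite !mxE.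
have [g gJ gV] := witt_extension (lt0r_neq0 c0) Pfree Qfree gramXV.
have gX : V *m g = X.
  have [mn|nm] := leqP m (n + n).
    apply/row_matrixP=> k; have km : (k < minn m (n + n))%N by rewrite (minn_idPl mn).
    have -> : k = h (Ordinal km) by apply: val_inj.
    by rewrite -!row_rowsub -mul_rowsub_mx gV.
  have free : row_free (J *m (rowsub h X)^T).
    rewrite /row_free eqmxMfull ?row_full_unit ?Jmx_unit // mxrank_tr (eqP Qfree).
    by rewrite (minn_idPr (ltnW nm)).
  apply/eqP; rewrite -subr_eq0 -(mulmx_free_eq0 _ free) mulmxBl subr_eq0.
  rewrite eq_sym [X *m (_ *m _)]mulmxA gram_top -gV trmx_mul !mulmxA.
  rewrite -[V *m g *m J]mulmxA -[V *m _ *m g^T]mulmxA gJ.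
  by rewrite -scalemxAr -scalemxAl.
exists g; first exact/in_CSpP.
rewrite /real_act -/V gX -[RHS]hsubmxK; congr row_mx; apply/matrixP=> k j.
rewrite ord1 mxE [RHS]mxE; have := radQ k; rewrite /radial /height -/X -/V.
by move=> e; lra.
Qed.

Lemma vanish_positive (p : {mpoly R[nvars n m]}) (k0 : 'I_m) :
  (forall P, 0 < radial P k0 -> p.@[coords P] = 0) -> p = 0.
Proof.
move=> p0; apply: poly_ext => P; rewrite meval0.
(* The function R_k0 is affine in u_k0, so every line in this direction meets the
   half-space R_k0 > 0 in a half-line. *)
pose E : point := delta_mx k0 (rshift (n + n) 0).
pose q : {poly R} := mmap polyC
  (fun i => (coords P i)%:P - (coords E i)%:P * 'X) p.
have qE t : q.[t] = p.@[coords (P - t *: E)].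
  rewrite /q /mmap mevalE horner_sum; apply: eq_bigr => x _.
  rewrite hornerM hornerC /mmap1 horner_prod; congr (_ * _).
  apply: eq_bigr => i _; rewrite horner_exp !hornerE /coords.
  by rewrite linearB linearZ /= !mxE mulrC.
have rad t : radial (P - t *: E) k0 = radial P k0 + 2 * t.
  have -> : radial (P - t *: E) k0 = halfform (row k0 (lsubmx P)) - 2 * height (P - t *: E) k0.
    congr (halfform (row k0 _) - _); apply/matrixP=> i j.
    by rewrite !mxE eq_lrshift andbF mulr0 subr0.
  have -> : height (P - t *: E) k0 = height P k0 - t.
    by rewrite /height !mxE !eqxx mulr1.
  by rewrite /radial; ring.
have q0 : q = 0.
  (* Along the line R_k0 equals [radial P k0 + 2 * t], which is positive beyond this bound. *)
  apply: (@poly_eq0_above _ _ (- (radial P k0 / 2))) => t tP.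
  by rewrite qE p0 // rad; lra.
by have := qE 0; rewrite q0 horner0 scale0r subr0.
Qed.

Lemma pull_polyM g lam p q :
  pull_poly g lam (p * q) = pull_poly g lam p * pull_poly g lam q :> {mpoly R[nvars n m]}.
Proof. exact: rmorphM. Qed.

Lemma pull_polyB g lam p q :
  pull_poly g lam (p - q) = pull_poly g lam p - pull_poly g lam q :> {mpoly R[nvars n m]}.
Proof. exact: rmorphB. Qed.

(** The action permutes the real points, so p is recovered from its pullback. *)
Lemma pull_poly_neq0 g lam (p : {mpoly R[nvars n m]}) :
  in_CSp g lam -> p != 0 -> pull_poly g lam p != 0.
Proof.
move=> gin; apply: contra_neq => p0; apply: poly_ext => P; rewrite meval0.
have lam0 : lam != 0 by case: gin => lam0 _; rewrite gt_eqF.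
have gu := CSp_unit gin.
rewrite -[P](@real_actK (invmx g) lam^-1) ?unitmx_inv ?invr_eq0 // invmxK invrK.
by rewrite -eval_pull p0 meval0.
Qed.

Lemma pull_rat_frac g lam (a b : {mpoly R[nvars n m]}) : in_CSp g lam -> b != 0 ->
  pull_rat g lam (a%:F / b%:F : ratfun R n m) =
  (pull_poly g lam a)%:F / (pull_poly g lam b)%:F.
Proof.
move=> gin b0; rewrite /pull_rat; set f := a%:F / b%:F.
set p := (frac _).1; set q := (frac _).2.
have q0 : q != 0 by apply: denom_ratioP.
have bF : b%:F != 0 by rewrite tofrac_eq0.
have pbaq : p * b = a * q.
  apply/eqP; rewrite -tofrac_eq !rmorphM /= /p -mulr_repr_denom -/q /f.
  by apply/eqP; rewrite mulrAC divfK.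
apply/eqP; rewrite eqr_div ?tofrac_eq0 ?pull_poly_neq0 // -!rmorphM.
by rewrite pbaq.
Qed.

(** Cross-multiplication turns invariance into an identity of polynomials, for any quotient a/b
    representing the function and not only the chosen representative. *)
Lemma invariant_fracP (a b : {mpoly R[nvars n m]}) : b != 0 ->
  invariant_field R n m (a%:F / b%:F) <->
  forall g lam, in_CSp g lam -> pull_poly g lam a * b = pull_poly g lam b * a.
Proof.
move=> b0; split=> inv g lam gin; have := inv g lam gin.
  rewrite pull_rat_frac // => /eqP; rewrite eqr_div ?tofrac_eq0 ?pull_poly_neq0 //.
  by rewrite -!rmorphM tofrac_eq => /eqP ->; rewrite mulrC.
move=> e; rewrite pull_rat_frac //; apply/eqP.
rewrite eqr_div ?tofrac_eq0 ?pull_poly_neq0 //.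
by rewrite -!rmorphM tofrac_eq e mulrC.
Qed.

Lemma invariant_field_divring :
  divring_closed [pred f | `[< invariant_field R n m f >]].
Proof.
have fracP (f : ratfun R n m) : exists a b : {mpoly R[nvars n m]},
    b != 0 /\ f = a%:F / b%:F.
  by exists (frac (repr f)).1, (frac (repr f)).2; rewrite denom_ratioP -frac_reprE.
split.
- apply/asboolP; rewrite -(divr1 1) -(rmorph1 (@tofrac _)).
  by apply/(invariant_fracP _ (oner_neq0 _)).
- move=> x y; have [a [b [b0 ->]]] := fracP x; have [c [d [d0 ->]]] := fracP y.
  move=> /asboolP/(invariant_fracP _ b0) ia /asboolP/(invariant_fracP _ d0) ic.
  apply/asboolP; rewrite -mulNr addf_div ?tofrac_eq0 // -!rmorphN -!rmorphM -rmorphD.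
  apply/invariant_fracP => [|g lam gin]; first exact: mulf_neq0.
  rewrite mulNr pull_polyB !pull_polyM mulrBl mulrBr.
  have := ia g lam gin; have := ic g lam gin.
  set a' := pull_poly _ _ a; set b' := pull_poly _ _ b.
  set c' := pull_poly _ _ c; set d' := pull_poly _ _ d => e e'.
  congr (_ - _).
    by rewrite mulrACA e' mulrACA.
  by rewrite [b * d]mulrC mulrACA e; ring.
- move=> x y; have [a [b [b0 ->]]] := fracP x; have [c [d [d0 ->]]] := fracP y.
  move=> /asboolP/(invariant_fracP _ b0) ia /asboolP/(invariant_fracP _ d0) ic.
  (* Closure under division includes division by 0, where the inverse is 0 by convention. *)
  have [->|c0] := eqVneq c 0.
    rewrite rmorph0 mul0r invr0 mulr0; apply/asboolP.
    rewrite -(mul0r (1%:F)^-1) -(rmorph0 (@tofrac _)).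
    apply/(invariant_fracP _ (oner_neq0 _)) => g lam _.
    by rewrite mulr0 mulr1 /pull_poly rmorph0.
  apply/asboolP; rewrite invf_div mulf_div -!rmorphM.
  apply/invariant_fracP => [|g lam gin]; first exact: mulf_neq0.
  rewrite !pull_polyM.
  have := ia g lam gin; have := ic g lam gin.
  set a' := pull_poly _ _ a; set b' := pull_poly _ _ b.
  set c' := pull_poly _ _ c; set d' := pull_poly _ _ d => e e'.
  by rewrite mulrACA e' [d' * c]mulrC -[c * d']mulrC -e mulrACA.
Qed.

End Contact.

(** * The rational slice *)

Section Generic.
Variables (R : realType) (n m : nat).
Local Notation J := (Jmx R n).
Local Notation point := 'M[R]_(m, n + n + 1).
Local Notation L := (ratfun R n m).
Local Notation top := (widen_ord (geq_minl m (n + n))).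

(** The u-coordinate is obtained by solving R_k = rho k. The field is arbitrary because both real
    points and the slice point Y are built this way. *)
Definition mkpoint (K : fieldType) (V : 'M[K]_(m, n + n)) (rho : 'I_m -> K) :
  'M[K]_(m, n + n + 1) := row_mx V (\col_k ((halfform (row k V) - rho k) / 2)).

Lemma lsubmx_mkpoint (V : 'M[R]_(m, n + n)) rho : lsubmx (mkpoint V rho) = V.
Proof. exact: row_mxKl. Qed.

Lemma radial_mkpoint (V : 'M[R]_(m, n + n)) rho k : radial (mkpoint V rho) k = rho k.
Proof.
by rewrite /radial lsubmx_mkpoint /height row_mxEr mxE; field.
Qed.

Definition base_frame (K : pzRingType) : 'M[K]_(m, n + n) :=
  \matrix_(i, j) ((i : nat) == j)%:R.

(** The explicit real point at which the R_k, the leading minor and the Gram determinant are seen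
    not to vanish. *)
Definition base_point : point := mkpoint (base_frame R) (fun=> 1).

Lemma radial_base_point k : radial base_point k = 1.
Proof. exact: radial_mkpoint. Qed.

Lemma gram_block_base :
  gram_block n m (extend_mx (gram base_point)) = J.
Proof.
apply/matrixP=> i j; rewrite mxE; case: ifP => // /andP[im jm].
rewrite (extend_mx_ord (gram base_point) (Ordinal im) (Ordinal jm)).
have rowE k (km : (k < m)%N) (kN : (k < n + n)%N) :
    row (Ordinal km) (base_frame R) = row (Ordinal kN) 1%:M.
  by apply/rowP=> l; rewrite !mxE -val_eqE.
have ordE (k : 'I_(n + n)) : Ordinal (ltn_ord k) = k by apply: val_inj.
rewrite gramE lsubmx_mkpoint (rowE _ _ (ltn_ord i)) (rowE _ _ (ltn_ord j)) omegaE.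
rewrite -row_mul mul1mx tr_row trmx1 [LHS]mxE (bigD1 j) //= big1 => [|k /negPf kj].
  by rewrite !ordE addr0 [X in X * _]mxE [X in _ * X]mxE [X in _ * X]mxE eqxx mulr1.
by rewrite !ordE [X in _ * X]mxE [X in _ * X]mxE kj mulr0.
Qed.

(** D is the leading minor of size min(m, 2n) of the matrix of vectors; it equals 1 at
    [base_point]. *)
Lemma generic_top_free : exists2 D : {mpoly R[nvars n m]}, D != 0 &
  forall P : point, D.@[coords P] != 0 -> top_free P.
Proof.
pose sub (S : Type) (V : 'M[S]_(m, n + n)) :=
  mxsub top (widen_ord (geq_minr m (n + n))) V.
pose D : {mpoly R[nvars n m]} := \det (sub _ (lsubmx (generic_point R n m)) :
  'M[{mpoly R[nvars n m]}]_(minn m (n + n))).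
have DE P : D.@[coords P] = \det (sub _ (lsubmx P)).
  rewrite -[LHS]/(evalp P D) -det_map_mx; congr (\det _).
  apply/matrixP=> i j; rewrite !mxE /=.
  have /matrixP/(_ (top i) (lshift 1 (widen_ord (geq_minr m (n + n)) j))) := evalp_generic P.
  by rewrite !mxE.
exists D.
  apply: (mpoly_neq0 (v := coords base_point)); rewrite DE.
  have -> : sub _ (lsubmx base_point) = 1%:M.
    by rewrite lsubmx_mkpoint; apply/matrixP=> i j; rewrite !mxE -val_eqE.
  by rewrite det1 oner_neq0.
move=> P; rewrite DE -unitfE -unitmxE /top_free => su.
have e : sub _ (lsubmx P) = rowsub top (lsubmx P) *m
    (rowsub (widen_ord (geq_minr m (n + n))) 1%:M)^T.
  apply/matrixP=> i j; rewrite [LHS]mxE [RHS]mxE.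
  rewrite (bigD1 (widen_ord (geq_minr m (n + n)) j)) //= big1 => [|k /negPf kj].
    by rewrite !mxE eqxx mulr1 addr0.
  by rewrite !mxE eq_sym kj mulr0.
rewrite /row_free eqn_leq rank_leq_row /=.
have /eqP {1}<- : row_free (sub _ (lsubmx P)) by rewrite row_free_unit.
by rewrite e mxrankM_maxl.
Qed.

Lemma specializes_mulmx v k l r (A : 'M[L]_(k, l)) (B : 'M[L]_(l, r))
    (A' : 'M[R]_(k, l)) (B' : 'M[R]_(l, r)) :
  (forall i j, specializes v (A i j) (A' i j)) ->
  (forall i j, specializes v (B i j) (B' i j)) ->
  forall i j, specializes v ((A *m B) i j) ((A' *m B') i j).
Proof.
move=> sA sB i j; rewrite !mxE; apply: specializes_sum => h.
exact: specializesM.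
Qed.

Lemma specializes_nat v k : specializes v (k%:R : L) k%:R.
Proof.
have := specializes_tofrac v (k%:R : {mpoly R[nvars n m]}).
by rewrite !rmorph_nat.
Qed.

Lemma specializes_Jmx v i j : specializes v (Jmx L n i j) (J i j).
Proof.
rewrite !mxE; case: split => i'; rewrite !mxE; case: split => j'; rewrite !mxE.
- exact: specializes0.
- exact: specializes_nat.
- by apply: specializesN; apply: specializes_nat.
- exact: specializes0.
Qed.

Lemma specializes_gram v (X : 'M[L]_(m, n + n)) (X' : 'M[R]_(m, n + n)) :
  (forall i j, specializes v (X i j) (X' i j)) -> forall i j,
  specializes v ((X *m Jmx L n *m X^T) i j) ((X' *m J *m X'^T) i j).
Proof.
move=> sX; apply: specializes_mulmx => [|i j]; last by rewrite !mxE.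
by apply: specializes_mulmx => // i j; apply: specializes_Jmx.
Qed.

Lemma specializes_halfform v (X : 'M[L]_(m, n + n)) (X' : 'M[R]_(m, n + n)) k :
  (forall i j, specializes v (X i j) (X' i j)) ->
  specializes v (halfform (row k X)) (halfform (row k X')).
Proof.
move=> sX; apply: specializes_sum => i.
by apply: specializesM; rewrite !mxE; apply: sX.
Qed.

Hypothesis m_gt0 : (0 < m)%N.
Local Notation lst := (last_factor m_gt0).

Definition normalized_gram : 'M[L]_m :=
  \matrix_(i, j) ((Rtwo R n i j)%:F / (Rone R n lst)%:F : L).

Definition normalized_radial (k : 'I_m) : L := (Rone R n k)%:F / (Rone R n lst)%:F.

Lemma specializes_normalized_gram (P : point) i j : radial P lst != 0 ->
  specializes (coords P) (normalized_gram i j) (gram P i j / radial P lst).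
Proof.
move=> r0; rewrite mxE; apply: specializesM.
  by rewrite -eval_Rtwo; apply: specializes_tofrac.
by apply: specializesV => //; rewrite -eval_Rone; apply: specializes_tofrac.
Qed.

Lemma specializes_normalized_radial (P : point) k : radial P lst != 0 ->
  specializes (coords P) (normalized_radial k) (radial P k / radial P lst).
Proof.
move=> r0; apply: specializesM.
  by rewrite -eval_Rone; apply: specializes_tofrac.
by apply: specializesV => //; rewrite -eval_Rone; apply: specializes_tofrac.
Qed.

Lemma det_normalized_gram : \det (gram_block n m (extend_mx normalized_gram)) != 0.
Proof.
apply: (@specializes_neq0 _ _ (coords base_point) _ (\det J)).
  by rewrite -unitfE -unitmxE Jmx_unit.
rewrite -gram_block_base; apply: specializes_det => i j; rewrite mxE [X in specializes _ _ X]mxE.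
case: ifP => [/andP[im jm]|_]; last exact: specializes_Jmx.
rewrite (extend_mx_ord (gram _) (Ordinal im) (Ordinal jm)).
rewrite (extend_mx_ord normalized_gram (Ordinal im) (Ordinal jm)).
have := @specializes_normalized_gram base_point (Ordinal im) (Ordinal jm).
by rewrite radial_mkpoint divr1; apply; apply: oner_neq0.
Qed.

Lemma Rtwo_alt i j : Rtwo R n i j = - Rtwo R n j i :> {mpoly R[nvars n m]}.
Proof. by rewrite /Rtwo opprB. Qed.

Lemma invariant_eval (a b : {mpoly R[nvars n m]}) g lam (P : point) :
  pull_poly g lam a * b = pull_poly g lam b * a ->
  a.@[coords (real_act g lam P)] * b.@[coords P] =
  b.@[coords (real_act g lam P)] * a.@[coords P].
Proof. by move=> ab; rewrite -!eval_pull -!mevalM ab. Qed.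

Section Slice.
Variable E : divringClosed L.
Hypothesis EC : forall c : R, ratconst R n m c \in E.
Hypothesis ET : {subset Tbar R n m_gt0 <= E}.

Lemma normalized_radial_in k : normalized_radial k \in E.
Proof.
have [km|] := boolP (k.+1 < m)%N.
  apply: ET; rewrite /Tbar mem_cat; apply/orP; left.
  apply/mapP; exists k => //.
  by rewrite mem_filter km mem_enum.
(* The one index missing from the list is the last, where the quotient is R_m/R_m. *)
rewrite -leqNgt => mk; have -> : k = lst.
  by apply: val_inj => /=; have := ltn_ord k; lia.
rewrite /normalized_radial; have [->|r0] := eqVneq ((Rone R n lst)%:F : L) 0.
  by rewrite mul0r rpred0.
by rewrite divff // rpred1.
Qed.

Lemma normalized_gram_in (i j : 'I_m) : (i < n + n)%N -> normalized_gram i j \in E.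
Proof.
have lt_in (i' j' : 'I_m) : (i' < n + n)%N -> (i' < j')%N -> normalized_gram i' j' \in E.
  move=> iN ij; apply: ET; rewrite mxE /Tbar mem_cat; apply/orP; right.
  apply/mapP; exists (i', j') => //.
  by rewrite mem_filter /= ij mul2n -addnn iN mem_enum.
move=> iN; have [ij|ji|/val_inj ->] := ltngtP i j.
- exact: lt_in.
- rewrite mxE Rtwo_alt rmorphN mulNr rpredN.
  by have := lt_in j i (ltn_trans ji iN) ji; rewrite mxE.
- by rewrite mxE /Rtwo subrr rmorph0 mul0r rpred0.
Qed.

(* The point Y has coordinates in E, and its specialization at a generic real
   point P with R_m(P) > 0 lies on the orbit of P. *)
Lemma slice : exists (Y : 'M[L]_(m, n + n + 1)) (D : {mpoly R[nvars n m]}),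
  [/\ Y \is a mxOver E, D != 0 &
    forall P : point, D.@[coords P] != 0 -> 0 < radial P lst ->
    exists Q : point, [/\ forall k j, specializes (coords P) (Y k j) (Q k j),
      top_free P, top_free Q,
      forall i j : 'I_m, (i < n + n)%N -> gram Q i j = (radial P lst)^-1 * gram P i j
      & forall k, radial Q k = (radial P lst)^-1 * radial P k]].
Proof.
have [i j|i|i j|| X [XE XA Xfree]] := @gram_realization_mx _ E n m normalized_gram.
- by rewrite !mxE Rtwo_alt rmorphN mulNr.
- by rewrite mxE /Rtwo subrr rmorph0 mul0r.
- exact: normalized_gram_in.
- exact: det_normalized_gram.
(* Independence over the function field could be lost at a real point. Where the right inverse Z has
   a value too, that value is a right inverse of the specialized rows, so they remain
   independent. *)
have [Z XZ] := row_freeP Xfree.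
pose Y := mkpoint X normalized_radial.
have [D1 D1n0 D1P] := common_domain (fun i => mxvec X 0 i : {fraction {mpoly R[nvars n m]}}).
have [D2 D2n0 D2P] := common_domain (fun i => mxvec Z 0 i : {fraction {mpoly R[nvars n m]}}).
have [D3 D3n0 D3P] := generic_top_free.
exists Y, (D1 * D2 * D3); split; last 1 first.
- move=> P; rewrite !mevalM !mulf_eq0 !negb_or -andbA => /and3P[D1v D2v D3v] r0.
  have rn0 : radial P lst != 0 by rewrite gt_eqF.
  have getmx k l (A : 'M[L]_(k, l)) :
      (forall i, exists c, specializes (coords P) (mxvec A 0 i) c) ->
      exists A' : 'M[R]_(k, l), forall i j, specializes (coords P) (A i j) (A' i j).
    move=> h; have [f fP] := fin_all_exists h.
    exists (vec_mx (\row_i f i)) => i j.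
    by have := fP (mxvec_index i j); rewrite mxvecE !mxE.
  have [X' sX] := getmx _ _ _ (D1P _ D1v).
  have [Z' sZ] := getmx _ _ _ (D2P _ D2v).
  exists (mkpoint X' (fun k => radial P k / radial P lst)); split.
  + move=> k j; rewrite /Y /mkpoint !mxE; case: split => j'; first exact: sX.
    rewrite !mxE; apply: specializesM; last first.
      by apply: specializesV; [rewrite pnatr_eq0|apply: specializes_nat].
    apply: specializesD; first exact: specializes_halfform.
    by apply: specializesN; apply: specializes_normalized_radial.
  + exact: D3P.
  + rewrite /top_free lsubmx_mkpoint; apply/row_freeP; exists Z'.
    apply/matrixP=> i j.
    have s1 : specializes (coords P) ((1%:M : 'M[L]__) i j) ((rowsub top X' *m Z') i j).
      by rewrite -XZ; apply: specializes_mulmx => // k l; rewrite mxE [X in specializes _ _ X]mxE.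
    apply: (specializes_uniq s1); rewrite mxE [X in specializes _ _ X]mxE.
    exact: specializes_nat.
  + move=> i j iN; rewrite /gram lsubmx_mkpoint mulrC.
    apply: (@specializes_uniq _ _ (coords P)); first exact: (specializes_gram sX).
    by rewrite XA //; apply: specializes_normalized_gram.
  + by move=> k; rewrite radial_mkpoint mulrC.
- apply/mxOverP=> k j; rewrite /Y /mkpoint mxE; case: split => j'.
    exact: (mxOverP XE).
  rewrite mxE rpredM ?rpredV ?rpred_nat // rpredB ?normalized_radial_in //.
  by apply: rpred_sum => i _; rewrite !mxE rpredM // (mxOverP XE).
- by rewrite !mulf_neq0.
Qed.

Lemma positive_point (p : {mpoly R[nvars n m]}) : p != 0 ->
  exists2 P : point, 0 < radial P lst & p.@[coords P] != 0.
Proof.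
move=> p0; apply: contrapT => noP; case/eqP: p0.
apply: (vanish_positive (k0 := lst)) => P r0; apply: contrapT => /eqP pP.
by apply: noP; exists P.
Qed.

(** The half-space R_m > 0 minus a hypersurface is Zariski dense, so values there decide whether f
    is zero. *)
Lemma vanish_specializes (f : L) (D : {mpoly R[nvars n m]}) : D != 0 ->
  (forall P : point, D.@[coords P] != 0 -> 0 < radial P lst ->
     specializes (coords P) f 0) -> f = 0.
Proof.
move=> D0 fP; apply/eqP; rewrite [f]frac_reprE mulf_eq0 tofrac_eq0; apply/orP; left.
apply: contrapT => /negP a0; have [P r0] := positive_point (mulf_neq0 a0 D0).
rewrite mevalM mulf_eq0 negb_or => /andP[aP DP].
have := specializes_tofrac (coords P) (\n_(repr f)); rewrite -mulr_repr_denom => s1.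
have s2 := specializesM (fP P DP r0) (specializes_tofrac (coords P) (\d_(repr f))).
by have := specializes_uniq s1 s2; rewrite mul0r => /eqP; rewrite (negPf aP).
Qed.

Lemma invariant_in f : invariant_field R n m f -> f \in E.
Proof.
have [Y [D [YE D0 DP]]] := slice.
rewrite [f]frac_reprE; set a := \n_(repr f); set b := \d_(repr f) => finv.
have b0 : b != 0 by apply: denom_ratioP.
have [P0 r0] := positive_point (mulf_neq0 b0 D0).
rewrite mevalM mulf_eq0 negb_or => /andP[bP0 DP0].
have [Q0 [sY0 Pfree Qfree gramQ radQ]] := DP _ DP0 r0.
have rn0 : radial P0 lst != 0 by rewrite gt_eqF.
have [h hin hQ0] : exists2 g, in_CSp g (radial P0 lst) & real_act g (radial P0 lst) Q0 = P0.
  apply: same_orbit => // [i j iN|k]; first by rewrite gramQ // mulVKf.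
  by rewrite radQ mulVKf.
(* f = a/b is replaced by (a o h)/(b o h), where h moves the slice point of P0 to
   P0 itself: this makes the denominator nonzero on the slice. *)
pose pull (p : {mpoly R[nvars n m]}) : {mpoly R[nvars n m]} := pull_poly h (radial P0 lst) p.
have fE : a%:F / b%:F = (pull a)%:F / (pull b)%:F :> L.
  apply/eqP; rewrite eqr_div ?tofrac_eq0 ?pull_poly_neq0 // -!rmorphM tofrac_eq.
  by have /(invariant_fracP _ b0)/(_ _ _ hin) := finv; rewrite -/(pull a) => ->; rewrite mulrC.
have pb0 : pull b != 0 by apply: pull_poly_neq0.
rewrite fE in finv *; move/(invariant_fracP _ pb0): finv => finv.
(* Substitution of the slice point into a polynomial: the result lies in E, as do the constants and
   the coordinates of Y. *)
pose onY p := mmap (ratconst R n m) (fun i => mxvec Y 0 i) p.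
have onYs (P Q : point) p : (forall k j, specializes (coords P) (Y k j) (Q k j)) ->
    specializes (coords P) (onY p) p.@[coords Q].
  move=> s; apply: specializes_mmap => i; case/mxvec_indexP: i => k j.
  by rewrite /coords !mxvecE.
have onYE p : onY p \in E.
  apply: rpred_sum => x _; apply: rpredM; first exact: EC.
  apply: rpred_prod => i _; apply: rpredX.
  by case/mxvec_indexP: i => k j; rewrite mxvecE (mxOverP YE).
have bY0 : onY (pull b) != 0.
  (* At P0 the value is that of [pull b] at Q0, that is of b at h Q0 = P0. *)
  apply: (specializes_neq0 _ (onYs _ _ _ sY0)).
  by rewrite eval_pull hQ0.
suff -> : (pull a)%:F / (pull b)%:F = onY (pull a) / onY (pull b) by rewrite rpred_div.
apply/eqP; rewrite eqr_div ?tofrac_eq0 // -subr_eq0; apply/eqP.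
apply: (vanish_specializes D0) => P DPn r; have [Q [sY Pf Qf gQ rQ]] := DP _ DPn r.
have ri : 0 < (radial P lst)^-1 by rewrite invr_gt0.
have [g gin gPQ] := same_orbit ri Pf Qf gQ rQ.
have e : (pull a).@[coords Q] * (pull b).@[coords P] =
         (pull b).@[coords Q] * (pull a).@[coords P].
  by rewrite -gPQ; apply: invariant_eval (finv _ _ gin).
have -> : 0 = (pull a).@[coords P] * (pull b).@[coords Q]
      + - ((pull a).@[coords Q] * (pull b).@[coords P]).
  by rewrite e; ring.
apply: specializesD; last apply: specializesN; apply: specializesM;
  by [apply: specializes_tofrac|apply: onYs].
Qed.

End Slice.

Lemma pull_Rone g lam k : in_CSp g lam ->
  pull_poly g lam (Rone R n k) = lam *: (Rone R n k : {mpoly R[nvars n m]}).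
Proof.
move=> gin; apply: poly_ext => P.
by rewrite eval_pull mevalZ !eval_Rone radial_act.
Qed.

Lemma pull_Rtwo g lam i j : in_CSp g lam ->
  pull_poly g lam (Rtwo R n i j) = lam *: (Rtwo R n i j : {mpoly R[nvars n m]}).
Proof.
move=> gin; apply: poly_ext => P.
by rewrite eval_pull mevalZ !eval_Rtwo gram_act // mxE.
Qed.

Lemma Rone_neq0 k : Rone R n k != 0 :> {mpoly R[nvars n m]}.
Proof.
apply: (mpoly_neq0 (v := coords base_point)).
by rewrite eval_Rone radial_mkpoint oner_neq0.
Qed.

Lemma Tbar_invariant f : f \in Tbar R n m_gt0 -> invariant_field R n m f.
Proof.
rewrite mem_cat => /orP[] /mapP[x _ ->]; apply/invariant_fracP; rewrite ?Rone_neq0 //;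
  move=> g lam gin; rewrite pull_Rone // ?pull_Rone ?pull_Rtwo //;
  by rewrite -!scalerAl mulrC.
Qed.

Lemma ratconst_invariant c : invariant_field R n m (ratconst R n m c).
Proof.
have := @invariant_fracP R n m (c%:MP) 1 (oner_neq0 _).
rewrite rmorph1 divr1 => -> g lam gin.
by rewrite /pull_poly comp_mpolyC comp_mpoly1 mulrC.
Qed.

(** Since [adjoin] is an intersection of subfields, one inclusion is [invariant_in] for each of
    them; the other takes the invariant field itself as the subfield. *)
Lemma invariant_fieldE :
  invariant_field R n m = adjoin (ratconst R n m) (Tbar R n m_gt0).
Proof.
apply/seteqP; split=> f.
  move=> finv E Ediv EC ET.
  pose E' : divringClosed L := HB.pack (E : L -> bool)
    (GRing.isDivringClosed.Build L (E : L -> bool) Ediv).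
  exact: (@invariant_in E').
move=> /(_ _ (@invariant_field_divring R n m)) h; apply/asboolP; apply: h.
  by move=> c; apply/asboolP; apply: ratconst_invariant.
by move=> t tT; apply/asboolP; apply: Tbar_invariant.
Qed.

End Generic.

(** * Algebraic independence and transcendence degree *)

Definition alt_mx (S : zmodType) m (w : 'I_m -> 'I_m -> S) : 'M[S]_m :=
  \matrix_(i, j) if (i < j)%N then w i j else if (j < i)%N then - w j i else 0.

Lemma gram_block_morph (S S' : pzRingType) (phi : {rmorphism S -> S'}) n m
    (w : 'I_m -> 'I_m -> S) :
  map_mx phi (gram_block n m (extend_mx (alt_mx w))) =
  gram_block n m (extend_mx (alt_mx (fun i j => phi (w i j)))).
Proof.
apply/matrixP=> i j; rewrite mxE [X in phi X]mxE [RHS]mxE; case: ifP => [/andP[im jm]|_].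
  rewrite (extend_mx_ord (alt_mx w) (Ordinal im) (Ordinal jm)).
  rewrite (extend_mx_ord (alt_mx _) (Ordinal im) (Ordinal jm)) !mxE.
  by case: ifP => // _; case: ifP => // _; rewrite ?rmorphN ?rmorph0.
rewrite !mxE; case: split => i'; rewrite !mxE; case: split => j'; rewrite !mxE;
  by rewrite ?rmorphN ?rmorph0 ?rmorph_nat.
Qed.

Section Independence.
Variables (R : realType) (n m : nat) (m_gt0 : (0 < m)%N).
Local Notation point := 'M[R]_(m, n + n + 1).
Local Notation L := (ratfun R n m).
Local Notation lst := (last_factor m_gt0).
Local Notation index_type := ('I_m + 'I_m * 'I_m)%type.

(** The symbols of the T's, kept apart from the fractions: symbols are visibly distinct, whereas
    distinctness of the fractions only follows from independence. *)
Definition Tbar_index : seq index_type :=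
  [seq inl k | k : 'I_m <- enum 'I_m & (k.+1 < m)%N] ++
  [seq inr ij | ij : 'I_m * 'I_m <- enum {: 'I_m * 'I_m} &
     (ij.1 < 2 * n)%N && (ij.1 < ij.2)%N].

Lemma Tbar_index_uniq : uniq Tbar_index.
Proof.
rewrite cat_uniq; apply/and3P; split.
- by rewrite map_inj_uniq => [|x y []//]; apply/filter_uniq/enum_uniq.
- by apply/hasPn => _ /mapP[ij _ ->]; apply/mapP => -[].
- by rewrite map_inj_uniq => [|x y []//]; apply/filter_uniq/enum_uniq.
Qed.

Definition T_of (s : index_type) : L :=
  match s with inl k => Tone R n m_gt0 k | inr ij => Ttwo R n m_gt0 ij.1 ij.2 end.

Definition T_value (P : point) (s : index_type) : R :=
  match s with inl k => radial P k | inr ij => gram P ij.1 ij.2 end / radial P lst.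

Lemma TbarE : Tbar R n m_gt0 = map T_of Tbar_index.
Proof. by rewrite map_cat -!map_comp. Qed.

Local Notation d := (size (Tbar R n m_gt0)).

Lemma size_Tbar_index : size Tbar_index = d.
Proof. by rewrite TbarE size_map. Qed.

Definition Tbar_nth (l : 'I_d) := nth (inl lst) Tbar_index l.

Lemma tnth_Tbar l : tnth (in_tuple (Tbar R n m_gt0)) l = T_of (Tbar_nth l).
Proof.
have nthE i : (Tbar R n m_gt0)`_i = nth 0 (map T_of Tbar_index) i by rewrite TbarE.
by rewrite (tnth_nth 0) /= nthE (nth_map (inl lst)) ?size_Tbar_index.
Qed.

(** Reads a family indexed by positions as one indexed by symbols, with value 0 at unlisted symbols
    such as T_ij with i beyond 2n. *)
Definition lookup (S : nmodType) (t : 'I_d -> S) (s : index_type) : S :=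
  if insub (index s Tbar_index) is Some l then t l else 0.

Lemma lookup_nth (S : nmodType) (t : 'I_d -> S) l : lookup t (Tbar_nth l) = t l.
Proof.
by rewrite /lookup index_uniq ?size_Tbar_index ?Tbar_index_uniq // valK.
Qed.

Lemma lookup_in (S : nmodType) (f : index_type -> S) s : s \in Tbar_index ->
  lookup (f \o Tbar_nth) s = f s.
Proof.
move=> sT; have lt_d : (index s Tbar_index < d)%N by rewrite -size_Tbar_index index_mem.
by rewrite /lookup insubT /= /Tbar_nth nth_index.
Qed.

Lemma specializes_Tbar (P : point) l : radial P lst != 0 ->
  specializes (coords P) (tnth (in_tuple (Tbar R n m_gt0)) l) (T_value P (Tbar_nth l)).
Proof.
rewrite tnth_Tbar => r0; case: (Tbar_nth l) => [k|[i j]] /=.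
  exact: specializes_normalized_radial.
by have := specializes_normalized_gram i j r0; rewrite mxE.
Qed.

Lemma inr_Tbar_index (i j : 'I_m) : (i < n + n)%N -> (i < j)%N -> inr (i, j) \in Tbar_index.
Proof.
move=> iN ij; rewrite mem_cat; apply/orP; right; apply/mapP; exists (i, j) => //.
by rewrite mem_filter /= ij mul2n -addnn iN mem_enum.
Qed.

Definition values_gram (S : pzRingType) (t : 'I_d -> S) : 'M[S]_(n + n) :=
  gram_block n m (extend_mx (alt_mx (fun i j => lookup t (inr (i, j))))).

(** Its zero set is the hypersurface outside which every tuple of reals is realized by the T's. *)
Definition gram_discriminant : {mpoly R[d]} := \det (values_gram (fun l => 'X_l)).

Lemma eval_gram_discriminant t : gram_discriminant.@[t] = \det (values_gram t).
Proof.
rewrite -[LHS]/(meval t (\det _)) -det_map_mx gram_block_morph;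
congr (\det (gram_block _ _ (extend_mx _))).
apply/matrixP=> i j; rewrite !mxE.
have e s : (lookup (fun l => 'X_l : {mpoly R[d]}) s).@[t] = lookup t s.
  by rewrite /lookup; case: insubP => [l _ _|_]; rewrite ?mevalXU ?meval0.
by rewrite /= !e.
Qed.

Lemma gram_discriminant_neq0 : gram_discriminant != 0.
Proof.
apply: (mpoly_neq0 (v := T_value (base_point R n m) \o Tbar_nth)).
rewrite eval_gram_discriminant.
have -> : values_gram (T_value (base_point R n m) \o Tbar_nth) = Jmx R n.
  rewrite -(gram_block_base R n m); apply/matrixP=> i j; rewrite mxE [RHS]mxE.
  case: ifP => // /andP[im jm].
  rewrite (extend_mx_ord (alt_mx _) (Ordinal im) (Ordinal jm)).
  rewrite (extend_mx_ord (gram _) (Ordinal im) (Ordinal jm)) mxE /=.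
  case: ltngtP => [ij|ji|/val_inj ij].
  - have := lookup_in (T_value (base_point R n m))
      (@inr_Tbar_index (Ordinal im) (Ordinal jm) (ltn_ord i) ij).
    by move=> ->; rewrite /T_value radial_base_point divr1.
  - have := lookup_in (T_value (base_point R n m))
      (@inr_Tbar_index (Ordinal jm) (Ordinal im) (ltn_ord j) ji).
    by move=> ->; rewrite /T_value radial_base_point divr1 -gram_alt.
  - have -> : Ordinal im = Ordinal jm by apply: val_inj; rewrite /= ij.
    by rewrite gramE /omega subrr.
by rewrite -unitfE -unitmxE Jmx_unit.
Qed.

Lemma divring_full : divring_closed (predT : {pred R}).
Proof. by []. Qed.

Lemma realize_values (t : 'I_d -> R) : gram_discriminant.@[t] != 0 ->
  exists2 P : point, radial P lst = 1 & forall l, T_value P (Tbar_nth l) = t l.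
Proof.
rewrite eval_gram_discriminant => tdet.
pose E : divringClosed R := HB.pack (predT : R -> bool)
  (GRing.isDivringClosed.Build R (predT : R -> bool) divring_full).
have [i j|i||| V [_ VA _]] := @gram_realization_mx _ E n m
    (alt_mx (fun i j => lookup t (inr (i, j)))) => //.
- by rewrite !mxE; case: ltngtP => _; rewrite ?opprK ?oppr0.
- by rewrite mxE ltnn.
(* With R_m = 1 the T's are the R's themselves. *)
pose P := mkpoint V (fun k => if (k.+1 < m)%N then lookup t (inl k) else 1).
have Plst : radial P lst = 1 by rewrite radial_mkpoint /= prednK // ltnn.
exists P => // l; rewrite /T_value Plst divr1 -[RHS]lookup_nth.
have : Tbar_nth l \in Tbar_index by rewrite mem_nth // size_Tbar_index.
rewrite mem_cat => /orP[] /mapP[x]; rewrite mem_filter => /andP[xP _] ->.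
  by rewrite radial_mkpoint xP.
case: x xP => i j /= /andP[iN ij].
by rewrite /gram lsubmx_mkpoint VA ?mxE ?ij // addnn -mul2n.
Qed.

(** A relation p vanishes at every realizable tuple, and the discriminant at every other one, so
    their product is zero. *)
Lemma Tbar_independent : alg_independent (ratconst R n m) (Tbar R n m_gt0).
Proof.
move=> p p0; suff /eqP : p * gram_discriminant = 0.
  by rewrite mulf_eq0 (negPf gram_discriminant_neq0) orbF => /eqP.
apply: mpoly_eq0 => t; rewrite mevalM.
have [->|tl] := eqVneq (gram_discriminant.@[t]) 0; first by rewrite mulr0.
have [P Plst Pt] := realize_values tl.
have s : specializes (coords P) (mmap (ratconst R n m)
    (tnth (in_tuple (Tbar R n m_gt0))) p) p.@[t].
  apply: specializes_mmap => l; rewrite -Pt.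
  by apply: specializes_Tbar; rewrite Plst oner_neq0.
rewrite p0 in s; rewrite -(specializes_uniq (specializes0 _) s).
by rewrite mul0r.
Qed.

(** Counts the pairs i < j < k with i < N: those with j < N give the binomial, and each j >= N gives
    N. *)
Lemma sum_minn N k : (\sum_(j < k) minn N j = 'C(minn N k, 2) + N * (k - N))%N.
Proof.
elim: k => [|k IHk]; first by rewrite big_ord0 minn0 sub0n muln0.
rewrite big_ord_recr /= IHk; have [kN|Nk] := leqP N k.
  by rewrite (minn_idPl (leqW kN)) subSn // mulnS; lia.
rewrite (minn_idPr Nk) binS bin1.
have [-> ->] : (k - N = 0 /\ k.+1 - N = 0)%N by lia.
by rewrite !muln0 !addn0.
Qed.

Lemma size_Tbar : d = (m.-1 + 'C(minn (2 * n) m, 2) + 2 * n * (m - 2 * n))%N.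
Proof.
have narrow N k : (N <= k)%N -> (\sum_(i < k | i < N) 1 = N)%N.
  by move=> Nk; rewrite -(big_ord_widen _ (fun=> 1%N)) // sum1_card card_ord.
rewrite -addnA -sum_minn /Tbar size_cat !size_map; congr (_ + _)%N.
  rewrite size_filter -sum1_count big_enum_cond /= -[RHS](narrow _ m) ?leq_pred //.
  by apply: eq_bigl => k; rewrite ltn_predRL.
rewrite size_filter -sum1_count big_enum_cond /=.
rewrite -(pair_big_dep xpredT (fun i j : 'I_m => (i < 2 * n) && (i < j))%N
  (fun _ _ => 1%N)) /=.
(* Counting by j, there are min(2n, j) admissible i, as indices start at 0. *)
rewrite (exchange_big_dep xpredT) //=; apply: eq_bigr => j _.
rewrite -[RHS](narrow _ m); last first.
  by rewrite (leq_trans (geq_minr _ _)) // ltnW.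
by apply: eq_bigl => i; rewrite leq_min.
Qed.

End Independence.

(** An independent generating family is a transcendence basis: each element z of the field is a root
    of X - z. *)
Lemma trdeg_adjoin (K L : fieldType) (iota : {rmorphism K -> L}) (s : seq L) :
  alg_independent iota s -> has_trdeg iota (adjoin iota s) (size s).
Proof.
move=> sfree; exists s => //; split=> // [z zs E _ _ sE|z zs]; first exact: sE.
exists ('X - z%:P); split; last by rewrite root_XsubC.
  by rewrite polyXsubC_eq0.
move=> i E Ediv EC ES; pose E' : divringClosed L := HB.pack (E : L -> bool)
    (GRing.isDivringClosed.Build L (E : L -> bool) Ediv).
rewrite coefB coefX coefC -[_ \in E]/(_ \in E').
rewrite rpredB ?rpred_nat //; case: ifP => _; last exact: rpred0.
exact: zs.
Qed.

Theorem mainTheorem5 (R : realType) (n m : nat)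
    (n_gt0 : (0 < n)%N) (m_gt0 : (0 < m)%N) :
  [/\ alg_independent (ratconst R n m) (Tbar R n m_gt0),
      invariant_field R n m
        = adjoin (ratconst R n m) (Tbar R n m_gt0),
      (2 * n <= m)%N ->
        has_trdeg (ratconst R n m) (invariant_field R n m)
          ((2 * n + 1) * m - n * (2 * n + 1) - 1)%N
    & (m <= 2 * n)%N ->
        has_trdeg (ratconst R n m) (invariant_field R n m)
          ('C(m, 2) + m - 1)%N
        /\ ('C(m, 2) + m - 1 = 'C(m.+1, 2) - 1)%N].
Proof.
have free := @Tbar_independent R n m m_gt0.
have trdeg := trdeg_adjoin free.
rewrite -invariant_fieldE in trdeg.
split=> //; first exact: invariant_fieldE.
  move=> nm; move: trdeg; rewrite size_Tbar (minn_idPl nm) bin2.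
  have -> : ((2 * n * (2 * n).-1)./2 = n * (2 * n).-1)%N.
    by rewrite -mulnA mul2n doubleK.
  suff -> : (m.-1 + n * (2 * n).-1 + 2 * n * (m - 2 * n) =
     (2 * n + 1) * m - n * (2 * n + 1) - 1)%N by [].
  (* Writing n = n' + 1 and m = 2n + k tames the truncated subtractions. *)
  clear free; case: n n_gt0 nm => // n' _ nm; have [k ->] : exists k, m = (2 * n'.+1 + k)%N.
    by exists (m - 2 * n'.+1)%N; rewrite subnKC.
  by nia.
move=> mn; move: trdeg; rewrite size_Tbar (minn_idPr mn).
rewrite (eqP (_ : m - 2 * n == 0)%N) ?subn_eq0 // muln0 addn0.
suff -> : (m.-1 + 'C(m, 2) = 'C(m, 2) + m - 1)%N by rewrite binS bin1.
by lia.
Qed.
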